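(* Let $d\in\mathbb{N}$, let $L\in\mathbb{N}$ with $L\ge d$, and let $A(L,d)$ be the randomized Smolyak method of level $L$ built from building blocks $U^{(n)}_l$ ($n=1,\dots,d$, $l\in\mathbb{N}$) approximating $S^{(n)}:F^{(n)}\to G^{(n)}$. Let $\mathrm{x}\in\{\mathrm{r},\mathrm{w}\}$. Assume that there are constants $B>0$, $D\in(0,1)$ and non-decreasing sequences of positive numbers $(C_l)_{l\in\mathbb{N}}$, $(E_l)_{l\in\mathbb{N}}$ such that for all $n=1,\dots,d$ and all $l\in\mathbb{N}$ $$\|S^{(n)}\|_{\mathrm{op}}\le B,\qquad e^{\mathrm{x}}(S^{(n)},U^{(n)}_l)\le C_l D^l .$$ If $\mathrm{x}=\mathrm{r}$, assume additionally that for all $n=1,\dots,d$, $l\in\mathbb{N}$: $U^{(n)}_lf\in L^2(\Omega^{(n)},G^{(n)})$ for all $f\in F^{(n)}$, and $$\sup_{\|f\|_{F^{(n)}}\le 1}\mathbb{E}\big[\|U^{(n)}_lf-U^{(n)}_{l-1}f\|^2\big]^{1/2}\le E_l D^l .$$ If $\mathrm{x}=\mathrm{w}$, assume additionally that for all $n=1,\dots,d$, $l\in\mathbb{N}$: $\mu_{l,n}(\omega_n):=\sup_{\|f\|_{F^{(n)}}\le1}\|(U^{(n)}_lf)(\omega_n)\|<\infty$ for all $\omega_n\in\Omega^{(n)}$, $\mu_{l,n}$ is measurable with $\|\mu_{l,n}\|_{L^2(\Omega^{(n)},\mathbb{R})}<\infty$, and $$\mathbb{E}\Big[\sup_{\|f\|_{F^{(n)}}\le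 1}\|U^{(n)}_lf-U^{(n)}_{l-1}f\|^2\Big]^{1/2}\le E_l D^l .$$ Then $$e^{\mathrm{x}}(S_d,A(L,d))\le C_L B^{d-1}D^{L-d+1}\sum_{j=0}^{d-1}\Big(\frac{E_{L-1}D}{B}\Big)^j\binom{L-d+j}{j}\le C_L H_L^{d-1}\binom{L}{d-1}D^L,$$ where $H_L=\max\{B/D,\,E_{L-1}\}$ (and $E_0:=E_1$).
   Context: $\mathbb{N}=\{1,2,\dots\}$. For $n=1,\dots,d$, $F^{(n)}$ is a separable Hilbert space of real-valued functions, $G^{(n)}$ is a separable Hilbert space, and $S^{(n)}:F^{(n)}\to G^{(n)}$ is a continuous linear operator. $F_d=F^{(1)}\otimes\cdots\otimes F^{(d)}$ and $G_d=G^{(1)}\otimes\cdots\otimes G^{(d)}$ are the Hilbert space tensor products and $S_d=S^{(1)}\otimes\cdots\otimes S^{(d)}:F_d\to G_d$. Norms on $G^{(n)}$ and $G_d$ are written $\|\cdot\|$. Randomized linear operator: for separable Hilbert spaces $F,G$ and a probability space $(\Omega,\Sigma,\mathbf{P})$, a map $A:\Omega\to L(F,G)$ (bounded linear operators) such that $\omega\mapsto A(\omega)f$, denoted $Af$, is a random variable with values in $G$ (Borel $\sigma$-field) for every $f\in F$. For a bounded linear $S:F\to G$ its randomized error and (root mean square) worst case error are $$e^{\mathrm r}(S,A)=\sup_{\|f\|_F\le1}\mathbb{E}\big[\|(S-A)f\|^2\big]^{1/2},\qquad e^{\mathrm w}(S,A)=\mathbb{E}\Big[\sup_{\|f\|_F\le1}\|(S-A)f\|^2\Big]^{1/2}.$$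 Building blocks: for each $n=1,\dots,d$, $(U^{(n)}_l)_{l\in\mathbb{N}}$ is a sequence of randomized linear operators $U^{(n)}_l:\Omega^{(n)}\to L(F^{(n)},G^{(n)})$ on a probability space $(\Omega^{(n)},\Sigma^{(n)},\mathbf{P}^{(n)})$. Put $U^{(n)}_0:=0$ and $\Delta^{(n)}_l:=U^{(n)}_l-U^{(n)}_{l-1}$ for $l\in\mathbb{N}$. Let $(\Omega,\Sigma,\mathbf{P})$ be the product of the spaces $(\Omega^{(n)},\Sigma^{(n)},\mathbf{P}^{(n)})$, $n=1,\dots,d$. For $\mathbf{l}\in\mathbb{N}^d$ write $|\mathbf{l}|=l_1+\dots+l_d$ and $Q(L,d)=\{\mathbf{l}\in\mathbb{N}^d: |\mathbf{l}|\le L\}$. Randomized Smolyak method of level $L\ge d$: the randomized linear operator on $\Omega$ $$A(L,d)(\omega)=\sum_{\mathbf{l}\in Q(L,d)}\bigotimes_{n=1}^d\Delta^{(n)}_{l_n}(\omega_n),\qquad \omega=(\omega_1,\dots,\omega_d)\in\Omega .$$ *)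

(* Defs.v *)
From HB Require Import structures.
From mathcomp Require Import all_boot all_order all_algebra.
From mathcomp Require Import all_classical all_reals all_analysis.
From mathcomp Require Import measurable_realfun.

Set Implicit Arguments.
Unset Strict Implicit.
Unset Printing Implicit Defensive.

Import Order.TTheory GRing.Theory Num.Theory.
Import numFieldNormedType.Exports.

Local Open Scope classical_set_scope.
Local Open Scope ring_scope.

HB.mixin Record isHilbert (R : realType) H of CompleteNormedModule R H := {
  hdot : {dot H for @idfun R};
  hdot_normE : forall x : H, `|x| ^+ 2 = hdot x x }.

#[short(type="hilbertType")]
HB.structure Definition Hilbert (R : realType) :=
  {H of CompleteNormedModule R H & isHilbert R H}.

Definition separable (T : topologicalType) : Prop :=
  exists2 A : set T, countable A & dense A.

(* [ev f x] is the value at x of the element f of F. *)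
Definition function_space (R : realType) (F : lmodType R) (X : Type)
    (ev : F -> X -> R) : Prop :=
  injective ev /\ forall x, scalar (ev ^~ x).

Definition bounded_operator (R : realType) (F G : normedModType R)
    (T : F -> G) : Prop :=
  linear T /\ continuous T.

(* The inner-product identity makes tens multilinear; together with density it
   determines (hcarrier, tens) up to a unique unitary isomorphism. *)
Record hilbert_tensor (R : realType) (d : nat) (F : 'I_d -> hilbertType R) :=
  HilbertTensor {
    hcarrier :> hilbertType R;
    tens : (forall n, F n) -> hcarrier;
    hdot_tens : forall f g : forall n, F n,
      hdot (tens f) (tens g) = \prod_(n < d) hdot (f n) (g n);
    dense_tens : dense [set h : hcarrier | exists m (a : 'I_m -> R)
      (f : 'I_m -> forall n, F n), h = \sum_(i < m) a i *: tens (f i)] }.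

Arguments tens {R d F} h f.

(* T_1 (x) ... (x) T_d for bounded linear operators T_n: there is exactly one
   bounded linear operator with these values on elementary tensors, so the
   default value [fun=> 0] plays no role. *)
Definition tensor_operator (R : realType) (d : nat)
    (F G : 'I_d -> hilbertType R) (Fd : hilbert_tensor F)
    (Gd : hilbert_tensor G) (T : forall n, F n -> G n) : Fd -> Gd :=
  xget (fun=> 0) [set A : Fd -> Gd | bounded_operator A /\
    forall f : forall n, F n, A (tens Fd f) = tens Gd (fun n => T n (f n))].

Arguments tensor_operator {R d F G} Fd Gd T.

Definition borel (T : ptopologicalType) := g_sigma_algebraType (@open T).

Section random_operators.
Context (R : realType) (disp : measure_display) (Om : measurableType disp)
  (P : probability Om R).
Local Open Scope ereal_scope.

Definition random_variable (G : normedModType R) (X : Om -> G) : Prop :=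
  measurable_fun [set: Om] (X : Om -> borel G).

Definition randomized_operator (F G : normedModType R)
    (A : Om -> F -> G) : Prop :=
  (forall w, bounded_operator (A w)) /\
  (forall f, random_variable (fun w => A w f)).

Definition in_L2 (G : normedModType R) (X : Om -> G) : Prop :=
  random_variable X /\ \int[P]_w (`|X w| ^+ 2)%:E < +oo.

End random_operators.

Definition operator_norm (R : realType) (F G : normedModType R)
    (T : F -> G) : \bar R :=
  ereal_sup [set `|T f|%:E | f in [set f : F | `|f| <= 1]].

Inductive setting := Randomized | WorstCase.

Section errors.
Context (R : realType) (disp : measure_display) (Om : measurableType disp)
  (P : probability Om R) (F G : normedModType R).
Local Open Scope ereal_scope.

Definition rms_norm (x : setting) (T : Om -> F -> G) : \bar R :=
  match x with
  | Randomized => ereal_sup [set sqrte (\int[P]_w (`|T w f| ^+ 2)%:E)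
                            | f in [set f : F | (`|f| <= 1)%R]]
  | WorstCase => sqrte (\int[P]_w
      ereal_sup [set (`|T w f| ^+ 2)%:E | f in [set f : F | (`|f| <= 1)%R]])
  end.

Definition rms_error (x : setting) (S : F -> G) (A : Om -> F -> G) : \bar R :=
  rms_norm x (fun w f => (S f - A w f)%R).

End errors.

Section product_space.
Context (d : nat) (disp : 'I_d -> measure_display)
  (Om : forall n, measurableType (disp n)).

Definition product_space := g_sigma_algebraType
  (\bigcup_n preimage_set_system [set: forall n, Om n] (fun w => w n)
     measurable).

Definition is_product_probability (R : realType)
    (P : forall n, probability (Om n) R) (PP : probability product_space R) :=
  forall A : forall n, set (Om n), (forall n, measurable (A n)) ->
    PP [set w : product_space | forall n, A n (w n)] =
    (\prod_(n < d) P n (A n))%E.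

End product_space.

Definition increment (R : realType) (F G : normedModType R) (Om : Type)
    (U : nat -> Om -> F -> G) (l : nat) (w : Om) (f : F) : G :=
  U l w f - U l.-1 w f.

(* l_n <= L for l in Q(L, d), so the index set is a finite set of functions
   into {0, ..., L}. *)
Definition smolyak (R : realType) (d : nat) (disp : 'I_d -> measure_display)
    (Om : forall n, measurableType (disp n)) (F G : 'I_d -> hilbertType R)
    (Fd : hilbert_tensor F) (Gd : hilbert_tensor G)
    (U : forall n, nat -> Om n -> F n -> G n) (L : nat)
    (w : product_space Om) (f : Fd) : Gd :=
  \sum_(l : {ffun 'I_d -> 'I_L.+1} |
        [forall n, 0 < l n]%N && (\sum_(n < d) l n <= L)%N)
    tensor_operator Fd Gd (fun n => increment (U n) (l n) (w n)) f.

Arguments smolyak {R d disp Om F G} Fd Gd U L w f.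

(* Main.v *)
(* Telescoping over the coordinates gives
     S_d - A(L,d) = sum over k < d and over multi-indices l in Q(L-d+k, k) of
       D_{l_1} (x) ... (x) D_{l_k} (x) (S - U_K) (x) S (x) ... (x) S,
   with D_l = U_l - U_{l-1} and K = L-d+k+1 - |l|.  There are 'C(L-d+k, k)
   multi-indices for each k, so it remains to bound the error norm of a tensor
   product of random operators on independent coordinates by the product of the
   error norms of its factors.  For h = sum_i a_i (x)_n f_{i,n}, the quantity
   E||(T_1 (x) ... (x) T_d) h||^2 is the value at a of the quadratic form whose
   matrix is the entrywise product over n of the matrices
   E<T_n f_{i,n}, T_n f_{k,n}>.  These are dominated by c_n^2 <f_{i,n}, f_{k,n}>
   in the Loewner order, and Schur's product theorem says that entrywise products
   preserve this domination.  The same argument without expectations bounds the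
   norm of a tensor product of bounded operators, hence yields its existence and
   the worst case bound. *)
Require Import Defs.
From HB Require Import structures.
From mathcomp Require Import all_boot all_order all_algebra.
From mathcomp Require Import all_classical all_reals all_analysis.
From mathcomp Require Import measurable_realfun.
From mathcomp Require Import ring lra.

Set Implicit Arguments.
Unset Strict Implicit.
Unset Printing Implicit Defensive.

Import Order.TTheory GRing.Theory Num.Theory.
Import numFieldNormedType.Exports.

Local Open Scope classical_set_scope.
Local Open Scope ring_scope.

(** * Positive semidefinite forms and Schur products *)

Section psd.
Context (R : realFieldType) (I : finType).
Implicit Types (M N : I -> I -> R) (a : I -> R) (i j k : I).

(** In the randomized setting a factor is controlled only for each fixed argument: E||T_n f||^2 <=
    c_n^2 ||f||^2 gives no majorant of ||T_n(w)|| at a given w, so the bound for the tensor product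
    cannot be obtained pointwise by multiplying operator norms. Gram matrices record the estimate
    for all linear combinations of finitely many arguments at once, and independence acts on them
    entrywise. A tensor product is accessible only through elementary tensors and their dense span.
    Identities and bounds are therefore checked on finite sums and then extended, by closedness for
    a fixed operator and by Fatou's lemma for expectations. The level K is what remains for the next
    coordinate once the k increments have used |l|. It makes the exponents of D in a summand add up
    to L-d+k+1 whatever l is, so all summands with the same k share the bound E_{L-1}^k C_L
    B^{d-1-k} D^{L-d+k+1}, and summing over l only counts. *)

Definition quadratic_form M a := \sum_i \sum_k a i * a k * M i k.

Definition psd M :=
  (forall i k, M i k = M k i) /\ forall a, 0 <= quadratic_form M a.

(** The Loewner order between positive semidefinite matrices. Positivity of the smaller matrix is
    part of the relation because entrywise multiplication preserves the order only for positive
    semidefinite factors. *)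
Definition psd_le M N := psd M /\ psd (fun i k => N i k - M i k).

Lemma psd_add M N : psd M -> psd N -> psd (fun i k => M i k + N i k).
Proof.
move=> [sM pM] [sN pN]; split=> [i k|a]; first by rewrite sM sN.
suff -> : quadratic_form (fun i k => M i k + N i k) a =
  quadratic_form M a + quadratic_form N a by rewrite addr_ge0.
rewrite -big_split; apply: eq_bigr => i _ /=.
by rewrite -big_split; apply: eq_bigr => k _; rewrite mulrDr.
Qed.

Lemma psd_le_psd M N : psd_le M N -> psd N.
Proof.
move=> [pM pMN]; suff -> : N = fun i k => M i k + (N i k - M i k).
  exact: psd_add.
by apply/funext => i; apply/funext => k; rewrite addrC subrK.
Qed.

(** Along one basis vector the form is a quadratic polynomial in t. Its nonnegativity for suitable t
    yields information on single entries and on Schur complements. *)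
Lemma quadratic_form_add_delta M a i t : (forall i k, M i k = M k i) ->
  quadratic_form M (fun k => a k + t * (k == i)%:R) =
  quadratic_form M a + 2 * t * (\sum_k a k * M k i) + t ^+ 2 * M i i.
Proof.
move=> sM.
have expand p q r s m : (p + t * r) * (q + t * s) * m = p * q * m +
  (t * (p * (s * m)) + t * (r * (q * m)) + t ^+ 2 * (r * (s * m))) by ring.
have collect q s m : q + (t * s + t * s + t ^+ 2 * m) = q + 2 * t * s + t ^+ 2 * m.
  by ring.
have sum_delta (F : I -> R) : \sum_k (k == i)%:R * F k = F i.
  rewrite (bigD1 i)//= eqxx mul1r big1 ?addr0// => k /negPf ->.
  by rewrite mul0r.
transitivity (quadratic_form M a +
   (t * (\sum_j a j * (\sum_k (k == i)%:R * M j k)) +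
    t * (\sum_j (j == i)%:R * (\sum_k a k * M j k)) +
    t ^+ 2 * \sum_j (j == i)%:R * (\sum_k (k == i)%:R * M j k))).
  rewrite !mulr_sumr -!big_split /=; apply: eq_bigr => j _.
  rewrite !mulr_sumr -!big_split /=; apply: eq_bigr => k _.
  exact: expand.
rewrite !sum_delta [in X in t * X + _](eq_bigr (fun k => a k * M k i)); last first.
  by move=> k _; rewrite sum_delta.
by rewrite [X in t * _ + t * X](eq_bigr (fun k => a k * M k i)) => [|k _];
  [exact: collect | rewrite sM].
Qed.

Lemma quadratic_form_delta M i : (forall i k, M i k = M k i) ->
  quadratic_form M (fun k => 0 + 1 * (k == i)%:R) = M i i.
Proof.
move=> sM; rewrite quadratic_form_add_delta//.
have -> : quadratic_form M (fun=> 0) = 0.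
  by rewrite /quadratic_form big1// => j _; rewrite big1// => k _; rewrite !mul0r.
have -> : \sum_k 0 * M k i = 0 by rewrite big1// => k _; rewrite mul0r.
by rewrite mulr0 !add0r expr1n mul1r.
Qed.

Lemma psd_diag M i : psd M -> 0 <= M i i.
Proof. by move=> [sM pM]; rewrite -quadratic_form_delta. Qed.

Lemma psd_diag0 M i k : psd M -> M i i = 0 -> M k i = 0.
Proof.
move=> pM Mii; apply/eqP; apply/negPn/negP => Mki0.
have [sM QM] := pM.
(* With [M i i = 0] the form at e_k + t e_i is affine in t; this t brings it down to -1. *)
pose t := - (M k k + 1) / (2 * M k i).
have := QM (fun j => (fun j => 0 + 1 * (j == k)%:R) j + t * (j == i)%:R).
rewrite quadratic_form_add_delta// Mii mulr0 addr0 quadratic_form_delta//.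
have -> : \sum_j (0 + 1 * (j == k)%:R) * M j i = M k i.
  rewrite (bigD1 k)//= eqxx add0r !mul1r big1 ?addr0// => j /negPf ->.
  by rewrite mulr0 addr0 mul0r.
suff -> : M k k + 2 * t * M k i = -1 by rewrite ler0N1.
by rewrite /t; field.
Qed.

(* Subtract from M the rank-one matrix built on row i, which empties that row:
   M is a sum of rank-one matrices, for which the claim is clear. *)
Theorem schur_product M N : psd M -> psd N -> psd (fun i k => M i k * N i k).
Proof.
move=> pM pN; have supp i : i \notin enum I -> forall k, M i k = 0.
  by rewrite mem_enum.
elim: (enum I) M pM supp => [|i s IHs] M pM supp.
  split=> [i k|a]; first by rewrite (proj1 pM) (proj1 pN).
  rewrite /quadratic_form big1// => i _; rewrite big1// => k _.
  by rewrite supp//= mul0r mulr0.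
have [sM QM] := pM; have [sN QN] := pN.
have [Mii|Mii] := eqVneq (M i i) 0.
  apply: IHs => // j js k; have [->|ji] := eqVneq j i.
    by rewrite sM (psd_diag0 _ pM).
  by rewrite supp// inE negb_or ji.
have Mii_gt0 : 0 < M i i by rewrite lt_neqAle eq_sym Mii psd_diag.
pose M' j k := M j k - M j i * M k i / M i i.
have pM' : psd M'.
  split=> [j k|a]; first by rewrite /M' sM [M j i * _]mulrC.
  (* This t minimizes the form along e_i, and the minimum is the value of the Schur complement [M']
     at a. *)
  pose t := - (\sum_k a k * M k i) / M i i.
  have := QM (fun k => a k + t * (k == i)%:R).
  rewrite quadratic_form_add_delta//; set S := \sum_k _.
  suff -> : quadratic_form M' a = quadratic_form M a - S ^+ 2 / M i i.
    suff -> : quadratic_form M a + 2 * t * S + t ^+ 2 * M i i =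
      quadratic_form M a - S ^+ 2 / M i i by [].
    by rewrite /t -/S; field.
  rewrite expr2 {1}/S !mulr_suml -sumrB; apply: eq_bigr => j _.
  rewrite /S mulr_sumr mulr_suml -sumrB; apply: eq_bigr => k _.
  by rewrite /M'; field.
have /IHs pM'N : forall j, j \notin s -> forall k, M' j k = 0.
  move=> j js k; rewrite /M'; have [->|ji] := eqVneq j i.
    by rewrite mulrAC divff// mul1r sM subrr.
  have j0 l : M j l = 0 by apply: supp; rewrite inE negb_or ji.
  by rewrite !j0 !mul0r subr0.
have -> : (fun j k => M j k * N j k) = fun j k => M' j k * N j k +
    (M j i * M k i / M i i) * N j k.
  by apply/funext => j; apply/funext => k; rewrite /M' mulrBl subrK.
apply: psd_add; first exact: pM'N.
split=> [j k|a]; first by rewrite sN [M j i * _]mulrC.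
have -> : quadratic_form (fun j k => M j i * M k i / M i i * N j k) a =
    (M i i)^-1 * quadratic_form N (fun j => a j * M j i).
  rewrite /quadratic_form mulr_sumr; apply: eq_bigr => j _; rewrite mulr_sumr.
  by apply: eq_bigr => k _; field.
by rewrite mulr_ge0// invr_ge0 ltW.
Qed.

(** One factor at a time: N_1 N' - M_1 M' = N_1 (N' - M') + (N_1 - M_1) M', and both summands are
    Schur products of positive semidefinite matrices. The empty product is the all-ones matrix,
    whose form is (sum_i a_i)^2. *)
Lemma psd_le_prod (J : Type) (r : seq J) (M N : J -> I -> I -> R) :
  (forall t : J, psd_le (M t) (N t)) ->
  psd_le (fun i k => \prod_(t <- r) M t i k) (fun i k => \prod_(t <- r) N t i k).
Proof.
move=> MN; elim: r => [|t r [pM pNM]].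
  have p1 : psd (fun _ _ => 1).
    split=> // a; suff -> : quadratic_form (fun _ _ => 1) a = (\sum_i a i) ^+ 2.
      by rewrite sqr_ge0.
    rewrite expr2 /quadratic_form mulr_suml; apply: eq_bigr => i _.
    by rewrite mulr_sumr; apply: eq_bigr => k _; rewrite mulr1.
  split.
    by under eq_fun do under eq_fun do rewrite big_nil.
  split=> [i k|a]; first by rewrite !big_nil.
  by rewrite /quadratic_form big1// => i _; rewrite big1// => k _;
    rewrite !big_nil subrr mulr0.
have [pMj pNMj] := MN t; have pNj := psd_le_psd (MN t).
split; under eq_fun do under eq_fun do rewrite !big_cons.
  exact: schur_product.
have := psd_add (schur_product pNj pNM) (schur_product pNMj pM).
congr psd; apply/funext => i; apply/funext => k; ring.
Qed.

Lemma psd_le_form M N a : psd_le M N -> quadratic_form M a <= quadratic_form N a.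
Proof.
move=> [_ [_ /(_ a) MN]]; rewrite -subr_ge0.
suff -> : quadratic_form N a - quadratic_form M a =
  quadratic_form (fun i k => N i k - M i k) a by [].
rewrite /quadratic_form -sumrB; apply: eq_bigr => i _; rewrite -sumrB.
by apply: eq_bigr => k _; rewrite mulrBr.
Qed.

End psd.

(** * Inner products and Gram matrices *)

Section hilbert.
Context (R : realType).

Lemma hdotC (H : hilbertType R) (x y : H) : hdot x y = hdot y x.
Proof. by rewrite hermC expr0 mul1r. Qed.

Lemma hdotDl (H : hilbertType R) (x y z : H) :
  hdot (x + y) z = hdot x z + hdot y z.
Proof. exact: linearDl. Qed.

Lemma hdotDr (H : hilbertType R) (x y z : H) :
  hdot z (x + y) = hdot z x + hdot z y.
Proof. exact: linearDr. Qed.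

Lemma hdotNl (H : hilbertType R) (x z : H) : hdot (- x) z = - hdot x z.
Proof. exact: linearNl. Qed.

Lemma hdotNr (H : hilbertType R) (x z : H) : hdot z (- x) = - hdot z x.
Proof. exact: linearNr. Qed.

Lemma hdotZl (H : hilbertType R) a (x z : H) : hdot (a *: x) z = a * hdot x z.
Proof. exact: linearZl_LR. Qed.

Lemma hdotZr (H : hilbertType R) a (x z : H) : hdot z (a *: x) = a * hdot z x.
Proof. by rewrite hdotC hdotZl hdotC. Qed.

Lemma hdot_sum (H : hilbertType R) (I : finType) (a : I -> R) (x : I -> H) y :
  hdot (\sum_i a i *: x i) y = \sum_i a i * hdot (x i) y.
Proof. by rewrite linear_sumlz; apply: eq_bigr => i _; rewrite linearZl_LR. Qed.

Lemma normsq_sum (H : hilbertType R) (I : finType) (a : I -> R) (x : I -> H) :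
  `|\sum_i a i *: x i| ^+ 2 = quadratic_form (fun i k => hdot (x i) (x k)) a.
Proof.
rewrite hdot_normE hdot_sum; apply: eq_bigr => i _.
rewrite hdotC hdot_sum mulr_sumr; apply: eq_bigr => k _.
by rewrite hdotC mulrA.
Qed.

(** Measurability and integrability of random operators are available for squared norms;
    polarization carries them over to inner products. *)
Lemma hdot_polar (H : hilbertType R) (x y : H) :
  hdot x y = 4^-1 * (`|x + y| ^+ 2 - `|x - y| ^+ 2).
Proof.
by rewrite !hdot_normE !(hdotDl, hdotDr, hdotNl, hdotNr) (hdotC y x); field.
Qed.

Lemma psd_gram (H : hilbertType R) (I : finType) (x : I -> H) :
  psd (fun i k => hdot (x i) (x k)).
Proof.
by split=> [i k|a]; [rewrite hdotC | rewrite -normsq_sum sqr_ge0].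
Qed.

End hilbert.

(** * Bounded operators *)

Section bounded_operators.
Context (R : realType).

Lemma bounded_operatorP (V W : normedModType R) (T : V -> W) :
  bounded_operator T <->
  linear T /\ exists2 c, 0 <= c & forall x, `|T x| <= c * `|x|.
Proof.
split=> [[lT cT]|[lT [c c0 Tc]]]; split=> //;
    pose T' : {linear V -> W} := HB.pack T (GRing.isLinear.Build _ _ _ _ T lT).
  have /linear_boundedP : bounded_near T' (nbhs 0).
    by apply/linear_bounded_continuous; exact: cT.
  move=> [M [_ bM]]; exists (Num.max M 0 + 1);
    first by rewrite addr_ge0// le_max lexx orbT.
  by apply: bM; rewrite (@le_lt_trans _ _ (Num.max M 0))// ?ltrDl ?le_max ?lexx.
apply: (@bounded_linear_continuous _ _ _ T'); apply/linear_boundedP.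
near=> r => x; apply: le_trans (Tc x) _; apply: ler_wpM2r => //.
Unshelve. all: by end_near. Qed.

Lemma linear_opP (V W : normedModType R) (T : V -> W) : linear T ->
  [/\ T 0 = 0, {morph T : x y / x + y}, {morph T : x y / x - y} &
      forall a, {morph T : x / a *: x}].
Proof.
move=> lT; pose T' : {linear V -> W} := HB.pack T (GRing.isLinear.Build _ _ _ _ T lT).
split; [exact: (linear0 T') | exact: (linearD T') | exact: (linearB T') |].
by move=> a x; exact: (linearZ_LR T').
Qed.

Lemma linear_op_sum (V W : normedModType R) (T : V -> W) m (a : 'I_m -> R) x :
  linear T -> T (\sum_i a i *: x i) = \sum_i a i *: T (x i).
Proof.
move=> lT; pose T' : {linear V -> W} := HB.pack T (GRing.isLinear.Build _ _ _ _ T lT).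
transitivity (\sum_i T (a i *: x i)); first exact: (linear_sum T').
by apply: eq_bigr => i _; exact: (linearZ_LR T').
Qed.

Lemma bounded_operator_cst0 (V W : normedModType R) :
  bounded_operator ((fun=> 0) : V -> W).
Proof.
by apply/bounded_operatorP; split=> [a x y|]; [rewrite scaler0 addr0|
  exists 0 => // x; rewrite normr0 mul0r].
Qed.

Lemma bounded_operatorB (V W : normedModType R) (T T' : V -> W) :
  bounded_operator T -> bounded_operator T' -> bounded_operator (fun x => T x - T' x).
Proof.
move=> [lT cT] [lT' cT']; split=> [a x y|x]; last exact: cvgB (cT x) (cT' x).
by rewrite lT lT' scalerBr opprD addrACA.
Qed.

Lemma bounded_operator_sum (V W : normedModType R) (I : Type) (r : seq I)
    (Q : pred I) (T : I -> V -> W) : (forall i, bounded_operator (T i)) ->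
  bounded_operator (fun x => \sum_(i <- r | Q i) T i x).
Proof.
move=> bT; elim: r => [|i r IHr].
  under eq_fun do rewrite big_nil; exact: bounded_operator_cst0.
under eq_fun do rewrite big_cons; case: (Q i) => //.
have [lT cT] := bT i; have [lr cr] := IHr.
split=> [a x y|x]; last exact: cvgD (cT x) (cr x).
by rewrite lT lr scalerDr addrACA.
Qed.

Lemma dense_ball (V : normedModType R) (A : set V) (x : V) (e : R) :
  dense A -> 0 < e -> exists2 y, A y & `|x - y| < e.
Proof.
move=> dA e0; have [] := dA (ball x e).
- by exists x; exact: ballxx.
- exact: ball_open.
by move=> y [xy Ay]; exists y; rewrite -?ball_normE//; move: xy; rewrite -ball_normE.
Qed.

Lemma dense_cvg (V : normedModType R) (A : set V) (x : V) :
  dense A -> exists2 y : nat -> V, forall k, A (y k) & y k @[k --> \oo] --> x.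
Proof.
move=> dA; have /choice[y Hy] : forall k, exists y, A y /\ `|x - y| < k.+1%:R^-1.
  move=> k; have [|y Ay xy] := @dense_ball V A x (k.+1%:R^-1) dA; last by exists y.
  by rewrite invr_gt0.
exists y => [k|]; first by have [] := Hy k.
apply/cvgrPdist_lt => e e0; near=> k.
have [_ /lt_trans] := Hy k; apply.
near: k; exact: (near_infty_natSinv_lt (PosNum e0)).
Unshelve. all: by end_near. Qed.

Lemma dense_closed (V : normedModType R) (A B : set V) :
  dense A -> closed B -> A `<=` B -> forall x, B x.
Proof.
move=> dA cB AB x; have [y Ay yx] := dense_cvg x dA.
by apply: (closed_cvg _ cB _ x yx); apply: nearW => k; exact/AB/Ay.
Qed.

(* The extension is the closure of the graph [Gr]. *)
Lemma bounded_extension (V : normedModType R) (W : completeNormedModType R)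
    (Gr : V -> W -> Prop) (c : R) : 0 <= c ->
  dense [set v | exists w, Gr v w] ->
  (forall a v w v' w', Gr v w -> Gr v' w' -> Gr (a *: v + v') (a *: w + w')) ->
  (forall v w, Gr v w -> `|w| <= c * `|v|) ->
  exists2 T : V -> W, bounded_operator T & forall v w, Gr v w -> T v = w.
Proof.
move=> c0 dG lG bG.
pose Cl v w := forall e, 0 < e ->
  exists v' w', [/\ Gr v' w', `|v - v'| < e & `|w - w'| < e].
have GrB v w v' w' : Gr v w -> Gr v' w' -> Gr (v' - v) (w' - w).
  by move=> G1 G2; have := lG (-1) _ _ _ _ G1 G2; rewrite !scaleN1r ![- _ + _]addrC.
have bCl v w : Cl v w -> `|w| <= c * `|v|.
  move=> Clvw; apply/ler_addgt0Pr => e e0.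
  have c1 : 0 < c + 1 by rewrite ltr_pwDr.
  have [|v' [w' [G' vv' ww']]] := Clvw (e / (c + 1)); first by rewrite divr_gt0.
  have -> : w = (w - w') + w' by rewrite subrK.
  apply: le_trans (ler_normD _ _) _.
  have h1 : `|v'| <= `|v| + `|v - v'|.
    by rewrite -[v' in leLHS](subKr v) (le_trans (ler_normB _ _)).
  have h2 : `|w'| <= c * (`|v| + `|v - v'|).
    by apply: le_trans (bG _ _ G') _; exact: ler_wpM2l.
  have h3 : c * `|v - v'| <= c * (e / (c + 1)) by apply: ler_wpM2l => //; exact: ltW.
  have h4 : e = e / (c + 1) + c * (e / (c + 1)) by field; rewrite gt_eqF.
  by rewrite mulrDr in h2; lra.
have lCl a v w v' w' : Cl v w -> Cl v' w' -> Cl (a *: v + v') (a *: w + w').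
  move=> C1 C2 e e0.
  have a1 : 0 < `|a| + 1 by rewrite ltr_pwDr.
  have e1 : 0 < e / (`|a| + 1) by rewrite divr_gt0.
  have [v1 [w1 [G1 vv1 ww1]]] := C1 _ e1; have [v2 [w2 [G2 vv2 ww2]]] := C2 _ e1.
  exists (a *: v1 + v2), (a *: w1 + w2); split; first exact: lG.
  - rewrite opprD addrACA -scalerBr (le_lt_trans (ler_normD _ _))// normrZ.
    have -> : e = `|a| * (e / (`|a| + 1)) + e / (`|a| + 1) by field; rewrite gt_eqF.
    by rewrite ler_ltD// ler_wpM2l// ltW.
  - rewrite opprD addrACA -scalerBr (le_lt_trans (ler_normD _ _))// normrZ.
    have -> : e = `|a| * (e / (`|a| + 1)) + e / (`|a| + 1) by field; rewrite gt_eqF.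
    by rewrite ler_ltD// ler_wpM2l// ltW.
have uCl v w w' : Cl v w -> Cl v w' -> w = w'.
  move=> C1 C2; have := lCl (-1) _ _ _ _ C1 C2; rewrite !scaleN1r addNr => /bCl.
  rewrite normr0 mulr0 normr_le0 addrC subr_eq0 => /eqP ->; exact.
(* The images of a sequence converging to v are Cauchy by the bound on differences, so completeness
   of W supplies the value at v. *)
have eCl v : exists w, Cl v w.
  have [y Gy yv] := dense_cvg v dG; have /choice[z Gz] := Gy.
  have : cauchy (z k @[k --> \oo]).
    apply/cauchyP => e e0; have c1 : 0 < c + 1 by rewrite ltr_pwDr.
    have e1 : 0 < e / (c + 1) / 2 by rewrite !divr_gt0.
    have /cvgrPdist_lt/(_ _ e1)[N _ HN] := yv.
    exists (z N); change (\forall k \near \oo, ball (z N) e (z k)).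
    near=> k; rewrite -ball_normE /=.
    apply: le_lt_trans (bG _ _ (GrB _ _ _ _ (Gz k) (Gz N))) _.
    have h1 : `|y N - y k| < e / (c + 1).
      rewrite (splitr (e / (c + 1))).
      have -> : y N - y k = (v - y k) - (v - y N)
        by rewrite opprB [RHS]addrC addrA subrK.
      apply: le_lt_trans (ler_normB _ _) _; apply: ltrD; apply: HN => /=//.
      by near: k; exists N.
    apply: (@le_lt_trans _ _ (c * (e / (c + 1)))).
      by rewrite ler_wpM2l// ltW.
    by rewrite mulrA ltr_pdivrMr// mulrC ltr_pM2l// ltrDl.
  move=> /cauchy_cvgP zc; exists (lim (z k @[k --> \oo])) => e e0.
  have /cvgrPdist_lt/(_ _ e0) y1 := yv.
  have /cvgrPdist_lt/(_ _ e0) z1 := zc.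
  near \oo => k; exists (y k), (z k); split=> //; by near: k.
have [T HT] := choice eCl.
exists T => [|v w Gvw].
  apply/bounded_operatorP; split=> [a v v'|]; last first.
    by exists c => // v; exact: bCl.
  by apply: uCl (HT _) _; exact: lCl.
by apply: uCl (HT v) _ => e e0; exists v, w; split; rewrite ?subrr ?normr0.
Unshelve. all: by end_near. Qed.

End bounded_operators.

(** * Tensor products *)

Lemma cvg_sqr (R : realType) (T : Type) (A : set_system T) {FA : Filter A}
    (u : T -> R) (l : R) :
  u x @[x --> A] --> l -> u x ^+ 2 @[x --> A] --> l ^+ 2.
Proof. by move=> ul; rewrite expr2; under eq_fun do rewrite expr2; exact: cvgM. Qed.

Section tensors.
Context (R : realType) (d : nat).
Implicit Types (F G : 'I_d -> hilbertType R).

Definition tensor_sums F (Fd : hilbert_tensor F) : set Fd :=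
  [set h : Fd | exists m (a : 'I_m -> R) (f : 'I_m -> forall n, F n),
     h = \sum_(i < m) a i *: tens Fd (f i)].

Lemma normsq_tensor_sum F (Fd : hilbert_tensor F) m (a : 'I_m -> R)
    (f : 'I_m -> forall n, F n) :
  `|\sum_(i < m) a i *: tens Fd (f i)| ^+ 2 =
  quadratic_form (fun i k => \prod_(n < d) hdot (f i n) (f k n)) a.
Proof.
rewrite normsq_sum; apply: eq_bigr => i _; apply: eq_bigr => k _.
by rewrite hdot_tens.
Qed.

(** Multilinearity is derived from inner products: the squared norm of the difference of the two
    sides expands into inner products of elementary tensors that differ only in coordinate n, and
    everything cancels. *)
Lemma tens_dfwith_linear F (Fd : hilbert_tensor F) (f : forall n, F n) n
    a (x y : F n) :
  tens Fd (dfwith f n (a *: x + y)) =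
  a *: tens Fd (dfwith f n x) + tens Fd (dfwith f n y).
Proof.
pose p := \prod_(m < d | m != n) hdot (f m) (f m).
have dotE u v : hdot (tens Fd (dfwith f n u)) (tens Fd (dfwith f n v)) =
    p * hdot u v.
  rewrite hdot_tens (bigD1 n)//= !dfwithin mulrC; congr (_ * _).
  by apply: eq_bigr => m mn; rewrite !dfwithout// eq_sym.
apply/eqP; rewrite -subr_eq0 -normr_eq0 -sqrf_eq0 hdot_normE.
rewrite !(hdotDl, hdotDr, hdotNl, hdotNr, hdotZl, hdotZr) !dotE.
rewrite !(hdotDl, hdotDr, hdotNl, hdotNr, hdotZl, hdotZr) (hdotC y x).
by apply/eqP; ring.
Qed.

Lemma gram_psd_le (V W : hilbertType R) (I : finType) (T : V -> W) (c : R)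
    (x : I -> V) : linear T -> (forall v, `|T v| ^+ 2 <= c * `|v| ^+ 2) ->
  psd_le (fun i k => hdot (T (x i)) (T (x k))) (fun i k => c * hdot (x i) (x k)).
Proof.
move=> lT Tc; split; first exact: psd_gram.
split=> [i k|a]; first by rewrite !(hdotC (x k)) (hdotC (T (x k))).
have := Tc (\sum_i a i *: x i).
have -> : T (\sum_i a i *: x i) = \sum_i a i *: T (x i).
  have [T0 TD _ TZ] := linear_opP lT.
  by rewrite (big_morph T TD T0); apply: eq_bigr => i _; rewrite TZ.
rewrite !normsq_sum -subr_ge0 => /le_trans; apply.
rewrite /quadratic_form mulr_sumr -sumrB ler_sum// => i _.
by rewrite mulr_sumr -sumrB ler_sum// => k _;
  rewrite -subr_ge0 [leRHS](_ : _ = 0)//; ring.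
Qed.

Lemma normsq_tensor_le F G (Fd : hilbert_tensor F) (Gd : hilbert_tensor G)
    (T : forall n, F n -> G n) (c : 'I_d -> R) m (a : 'I_m -> R)
    (f : 'I_m -> forall n, F n) :
  (forall n, linear (T n)) ->
  (forall n v, `|T n v| ^+ 2 <= c n * `|v| ^+ 2) ->
  `|\sum_(i < m) a i *: tens Gd (fun n => T n (f i n))| ^+ 2 <=
  (\prod_n c n) * `|\sum_(i < m) a i *: tens Fd (f i)| ^+ 2.
Proof.
move=> lT Tc; rewrite !normsq_tensor_sum.
have /(psd_le_form a)/le_trans -> // := psd_le_prod (index_enum 'I_d)
  (fun n => gram_psd_le (fun i : 'I_m => f i n) (lT n) (Tc n)).
rewrite /quadratic_form mulr_sumr ler_sum// => i _.
by rewrite mulr_sumr ler_sum// => k _; rewrite big_split /= mulrCA.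
Qed.

Lemma dense_tensor_sums F (Fd : hilbert_tensor F) : dense (tensor_sums (Fd := Fd)).
Proof. exact: dense_tens. Qed.

Lemma tensor_operatorP F G (Fd : hilbert_tensor F) (Gd : hilbert_tensor G)
    (T : forall n, F n -> G n) : (forall n, bounded_operator (T n)) ->
  bounded_operator (tensor_operator Fd Gd T) /\
  forall f, tensor_operator Fd Gd T (tens Fd f) = tens Gd (fun n => T n (f n)).
Proof.
move=> bT; have lT n : linear (T n) := proj1 (bT n).
have /choice[c Hc] : forall n, exists c, 0 <= c /\ forall v, `|T n v| <= c * `|v|.
  by move=> n; have /bounded_operatorP[_ [c c0 Tc]] := bT n; exists c.
(* A vector may be a tensor sum in many ways, so the assignment is first only a relation. The norm
   bound, applied to differences, makes it single-valued. *)
pose Gr v w := exists m (a : 'I_m -> R) (f : 'I_m -> forall n, F n),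
  v = \sum_(i < m) a i *: tens Fd (f i) /\
  w = \sum_(i < m) a i *: tens Gd (fun n => T n (f i n)).
apply: (@xgetPex _ (fun=> 0) [set A : Fd -> Gd | bounded_operator A /\
  forall f, A (tens Fd f) = tens Gd (fun n => T n (f n))]).
have [||t v w v' w'|v w [m [a [f [-> ->]]]]|A bA AG] :=
    @bounded_extension R Fd Gd Gr (\prod_n c n).
- by apply: prodr_ge0 => n _; exact: (Hc n).1.
- suff -> : [set v | exists w, Gr v w] = tensor_sums (Fd := Fd).
    exact: dense_tensor_sums.
  apply/seteqP; split=> [v [w [m [a [f [-> _]]]]]|v [m [a [f ->]]]].
    by exists m, a, f.
  by exists (\sum_(i < m) a i *: tens Gd (fun n => T n (f i n))), m, a, f.
- move=> [m [b [f [-> ->]]]] [m' [b' [f' [-> ->]]]].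
  exists (m + m')%N.
  exists (fun i => match fintype.split i with inl j => t * b j | inr j => b' j end).
  exists (fun i => match fintype.split i with inl j => f j | inr j => f' j end).
  by split; rewrite big_split_ord scaler_sumr /=; congr (_ + _);
    apply: eq_bigr => i _; rewrite ?(unsplitK (inl i)) ?(unsplitK (inr i)) ?scalerA.
- rewrite -ler_sqr ?nnegrE ?mulr_ge0 ?prodr_ge0// => [|n _]; last exact: (Hc n).1.
  rewrite exprMn -prodrXl; apply: normsq_tensor_le => // n u.
  rewrite -exprMn ler_sqr ?nnegrE ?mulr_ge0//; [exact: (Hc n).2|exact: (Hc n).1].
exists A; split=> // f; apply: AG.
exists 1%N, (fun=> 1), (fun=> f).
by rewrite !big_ord1 !scale1r.
Qed.

Lemma tensor_operator_sums F G (Fd : hilbert_tensor F) (Gd : hilbert_tensor G)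
    (T : forall n, F n -> G n) m (a : 'I_m -> R) (f : 'I_m -> forall n, F n) :
  (forall n, bounded_operator (T n)) ->
  tensor_operator Fd Gd T (\sum_(i < m) a i *: tens Fd (f i)) =
  \sum_(i < m) a i *: tens Gd (fun n => T n (f i n)).
Proof.
move=> /(tensor_operatorP Fd Gd) [[lT _] TE].
by rewrite linear_op_sum//; apply: eq_bigr => i _; rewrite TE.
Qed.

Lemma eq_bounded_tensor F (W : normedModType R) (Fd : hilbert_tensor F)
    (A A' : Fd -> W) : bounded_operator A -> bounded_operator A' ->
  (forall f, A (tens Fd f) = A' (tens Fd f)) -> A =1 A'.
Proof.
move=> bA bA' AA' h; have [lB cB] := bounded_operatorB bA bA'.
apply/eqP; rewrite -subr_eq0 -normr_le0.
apply: (@dense_closed _ _ _ [set h | `|A h - A' h| <= 0]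
  (dense_tensor_sums (Fd := Fd))).
  apply: (@preimage_closed _ _ (fun h => `|A h - A' h|) [set r | r <= 0]).
    by move=> x _; apply: cvg_norm; exact: cB.
  exact: closed_le.
move=> _ [m [a [f ->]]] /=.
rewrite (linear_op_sum _ _ (proj1 bA)) (linear_op_sum _ _ (proj1 bA')) -sumrB.
by rewrite big1 ?normr0// => i _; rewrite AA' subrr.
Qed.

Lemma normsq_tensor_operator F G (Fd : hilbert_tensor F) (Gd : hilbert_tensor G)
    (T : forall n, F n -> G n) (c : 'I_d -> R) h :
  (forall n, bounded_operator (T n)) ->
  (forall n v, `|T n v| ^+ 2 <= c n * `|v| ^+ 2) ->
  `|tensor_operator Fd Gd T h| ^+ 2 <= (\prod_n c n) * `|h| ^+ 2.
Proof.
move=> bT Tc; have [[lA cA] AE] := tensor_operatorP Fd Gd bT.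
rewrite -subr_ge0.
apply: (@dense_closed _ _ _ [set h | 0 <= (\prod_n c n) * `|h| ^+ 2 -
  `|tensor_operator Fd Gd T h| ^+ 2] (dense_tensor_sums (Fd := Fd))).
  apply: (@preimage_closed _ _ (fun h => (\prod_n c n) * `|h| ^+ 2 -
    `|tensor_operator Fd Gd T h| ^+ 2) [set r | 0 <= r]).
    move=> x _; apply: cvgB.
      by apply: cvgMr; apply: cvg_sqr; exact: norm_continuous.
    by apply: cvg_sqr; apply: cvg_norm; exact: cA.
  exact: closed_ge.
move=> _ [m [a [f ->]]] /=; rewrite subr_ge0 tensor_operator_sums//.
by apply: normsq_tensor_le => // n; exact: (proj1 (bT n)).
Qed.

End tensors.

(** * Multi-indices and telescoping *)

Section multi_indices.
Context (d L : nat).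
Implicit Types (l : {ffun 'I_d -> 'I_L.+1}) (k : 'I_d).

(* Multi-indices in Q(N, k), padded by 0 in the coordinates n >= k. *)
Definition padded_index (k N : nat) l :=
  [forall n : 'I_d, (0 < l n)%N == (n < k)%N] && (\sum_(n < d) l n <= N)%N.

Definition index_update l k (t : 'I_L.+1) : {ffun 'I_d -> 'I_L.+1} :=
  [ffun n => if n == k then t else l n].

Lemma sum_index_update l k t : l k = ord0 ->
  (\sum_n index_update l k t n = \sum_n l n + t)%N.
Proof.
move=> lk; rewrite (bigD1 k)//= ffunE eqxx [in RHS](bigD1 k)//= lk add0n addnC.
by congr addn; apply: eq_bigr => n /negPf nk; rewrite ffunE nk.
Qed.

(** An index of Q(N+1, k+1) is an index of Q(N, k) followed by a last entry t >= 1; positivity of t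
    costs one unit of level. Resetting coordinate k to 0 recovers the shorter index. *)
Lemma big_padded_indexS (V : nmodType) k N (H : {ffun 'I_d -> 'I_L.+1} -> V) :
  \sum_(l | padded_index k.+1 N.+1 l) H l =
  \sum_(l | padded_index k N l)
    \sum_(t : 'I_L.+1 | (0 < t)%N && (\sum_n l n + t <= N.+1)%N)
      H (index_update l k t).
Proof.
rewrite (reindex_onto (fun p => index_update p.1 k p.2)
  (fun l => (index_update l k ord0, l k))); last first.
  move=> l _; apply/ffunP => n; rewrite !ffunE /=.
  by case: eqP => // ->.
rewrite pair_big_dep /=; apply: eq_bigl => -[l t] /=.
rewrite xpair_eqE ffunE eqxx eqxx andbT.
have -> : (index_update (index_update l k t) k ord0 == l) = (l k == ord0).
  apply/eqP/eqP => [<-|lk]; first by rewrite ffunE eqxx.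
  by apply/ffunP => n; rewrite !ffunE; case: eqP => // ->.
have [lk|lk] := eqVneq (l k) ord0; last first.
  rewrite andbF; symmetry; apply/negbTE; rewrite negb_and; apply/orP; left.
  rewrite negb_and negb_forall; apply/orP; left; apply/existsP; exists k.
  by rewrite ltnn lt0n; move: lk; rewrite -val_eqE /= => ->.
rewrite andbT /padded_index sum_index_update//.
have -> : [forall n, (0 < index_update l k t n)%N == (n < k.+1)%N] =
    [forall n, (0 < l n)%N == (n < k)%N] && (0 < t)%N.
  apply/forallP/andP => [H1|[/forallP H1 t0] n].
    split; last by have := H1 k; rewrite ffunE eqxx ltnSn => /eqP.
    apply/forallP => n; have := H1 n; rewrite ffunE.
    case: (eqVneq n k) => [->|nk] _; first by rewrite lk ltnn.
    have := H1 n; rewrite ffunE (negPf nk) => /eqP ->.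
    by rewrite ltnS leq_eqVlt val_eqE (negPf nk).
  rewrite ffunE; case: (eqVneq n k) => [->|nk]; first by rewrite t0 ltnSn.
  by rewrite (eqP (H1 n)) ltnS [in X in _ == X]leq_eqVlt val_eqE (negPf nk).
case: [forall _, _] => //=; case: (posnP t) => //= t0; first by rewrite andbF.
by rewrite andb_idl// => lt_N; rewrite -ltnS (leq_trans _ lt_N)// -addn1 leq_add2l.
Qed.

Lemma big_shifted_range (V : nmodType) s M (H : nat -> V) : (M <= L)%N ->
  \sum_(t < L.+1 | (0 < t)%N && (s + t <= M)%N) H t = \sum_(1 <= t < (M - s).+1) H t.
Proof.
move=> ML; rewrite -(big_mkord (fun t => (0 < t)%N && (s + t <= M)%N)).
rewrite [RHS](big_nat_widen _ _ L.+1);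
  last by rewrite ltnS leq_subLR (leq_trans ML) ?leq_addl.
rewrite [RHS](big_nat_widenl _ 0)//; apply: eq_bigl => t.
by case: (posnP t) => [->|t0]; rewrite ?andbF// ltnS andbT leq_psubRL.
Qed.




(** Pascal's rule: an index l of Q(N, k) admits N+1-|l| last entries in Q(N+1, k+1). One of them for
    each l accounts for Q(N, k), and the remaining N-|l| add up to Q(N, k+1). *)
Lemma card_padded_index (k N : nat) : (k <= d)%N -> (N <= L)%N ->
  (\sum_(l | padded_index k N l) 1 = 'C(N, k))%N.
Proof.
elim: k N => [|k IHk] N kd NL.
  rewrite bin0 (big_pred1 [ffun=> ord0])// => l; rewrite /padded_index /=.
  apply/idP/eqP => [/andP[/forallP l0 _]|->]; last first.
    apply/andP; split; first by apply/forallP => n; rewrite ffunE.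
    by rewrite big1// => n _; rewrite ffunE.
  by apply/ffunP => n; apply/val_inj; move: (l0 n); rewrite ffunE /=;
    case: (nat_of_ord (l n)).
elim: N NL => [|N IHN] NL.
  rewrite big1// => l /andP[/forallP/(_ (Ordinal kd))/eqP/=]; rewrite ltnSn => l0.
  by rewrite leqNgt (leq_trans l0)// (bigD1 (Ordinal kd))//= leq_addr.
rewrite (big_padded_indexS (Ordinal kd)) binS -IHN ?(ltnW NL)//
  -[in RHS](IHk N) ?(ltnW NL) ?(ltnW kd)//.
have inner l : padded_index k N l ->
    (\sum_(t < L.+1 | (0 < t)%N && (\sum_n l n + t <= N.+1)%N) 1 =
      (N - \sum_n l n) + 1)%N.
  move=> /andP[_ lN]; rewrite (@big_shifted_range nat _ _ (fun=> 1%N))//.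
  by rewrite sum_nat_const_nat muln1 subSS subn0 subSn// addn1.
rewrite (eq_bigr _ inner) big_split /=; congr addn.
case: N NL IHN inner => [|N] NL IHN inner.
  rewrite big1// [RHS]big1// => l /andP[/forallP/(_ (Ordinal kd))/eqP/=];
    rewrite ltnSn => l0.
  by rewrite leqNgt (leq_trans l0)// (bigD1 (Ordinal kd))//= leq_addr.
rewrite (big_padded_indexS (Ordinal kd)).
(* Indices that fill the whole level admit no further entry and contribute 0, so only those of the
   next smaller level remain. *)
rewrite [LHS](bigID (fun l : {ffun 'I_d -> 'I_L.+1} => \sum_n l n <= N)%N)/=
  [X in _ + X]big1; last first.
  by move=> l /andP[/andP[_ l1]]; rewrite -ltnNge => l2; apply/eqP; rewrite subn_eq0.
rewrite addr0; apply: eq_big => [l|l /andP[/andP[_ _ ] lN]].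
  rewrite /padded_index -andbA; congr andb.
  by rewrite andb_idl// => /leq_trans; apply.
rewrite (@big_shifted_range nat _ _ (fun=> 1%N)) 1?ltnW//.
by rewrite sum_nat_const_nat muln1 subSS subn0.
Qed.

End multi_indices.

(** Hockey-stick identity; with N = L-d and k = d-1 it produces the binomial coefficient of the
    second estimate. *)
Lemma sum_bin_diagonal N k : (\sum_(j < k.+1) 'C(N + j, j) = 'C((N + k).+1, k))%N.
Proof.
elim: k => [|k IHk]; first by rewrite big_ord1 addn0 !bin0.
by rewrite big_ord_recr /= IHk addnS binS addnC.
Qed.

Section telescoping.
Context (R : realType) (d : nat).

(** The same case distinction serves three choices of [V]: vectors of an elementary tensor, random
    operators, and the real numbers bounding their error norms. *)
Definition split_factor (V : 'I_d -> Type) (k : nat) (x y z : forall n, V n)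
    (n : 'I_d) : V n :=
  if (n < k)%N then x n else if nat_of_ord n == k then y n else z n.

Lemma tens_dfwith_sum (G : 'I_d -> hilbertType R) (Gd : hilbert_tensor G)
    (f : forall n, G n) (n : 'I_d) (I : Type) (r : seq I) (Q : pred I)
    (x : I -> G n) :
  \sum_(i <- r | Q i) tens Gd (dfwith f n (x i)) =
  tens Gd (dfwith f n (\sum_(i <- r | Q i) x i)).
Proof.
have t0 : tens Gd (dfwith f n 0) = 0.
  by have := tens_dfwith_linear Gd f (-1) (0 : G n) 0;
    rewrite scaler0 addr0 scaleN1r addNr.
elim: r => [|i r IHr]; first by rewrite !big_nil t0.
rewrite !big_cons; case: (Q i) => //; rewrite IHr.
by have := tens_dfwith_linear Gd f 1 (x i) (\sum_(j <- r | Q j) x j);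
  rewrite !scale1r => ->.
Qed.

Lemma tens_dfwithB (G : 'I_d -> hilbertType R) (Gd : hilbert_tensor G)
    (f : forall n, G n) (n : 'I_d) (x y : G n) :
  tens Gd (dfwith f n x) - tens Gd (dfwith f n y) = tens Gd (dfwith f n (x - y)).
Proof.
have := tens_dfwith_linear Gd f (-1) y x; rewrite !scaleN1r [in RHS]addrC => <-.
by rewrite addrC.
Qed.

(** The sums [Pk k], with increments over Q(L-d+k, k) in the first k coordinates and v in the
    others, interpolate between the elementary tensor (k = 0) and the Smolyak sum (k = d). In
    [Pk k.+1] the sum over the last entry t telescopes to u_K because u_0 = 0, so consecutive sums
    differ by v - u_K in coordinate k. *)
Lemma smolyak_telescope (G : 'I_d -> hilbertType R) (Gd : hilbert_tensor G)
    (v : forall n, G n) (u : forall n, nat -> G n) (L : nat) : (d <= L)%N ->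
  (forall n, u n 0%N = 0) ->
  tens Gd v - \sum_(l : {ffun 'I_d -> 'I_L.+1} |
      [forall n, 0 < l n]%N && (\sum_(n < d) l n <= L)%N)
    tens Gd (fun n => u n (l n) - u n (l n).-1) =
  \sum_(k < d) \sum_(l : {ffun 'I_d -> 'I_L.+1} | padded_index k (L - d + k) l)
    tens Gd (split_factor k (fun n => u n (l n) - u n (l n).-1)
      (fun n => v n - u n ((L - d + k).+1 - \sum_m l m)%N) v).
Proof.
move=> dL u0; pose x (l : {ffun 'I_d -> 'I_L.+1}) n := u n (l n) - u n (l n).-1.
pose Pk k := \sum_(l : {ffun 'I_d -> 'I_L.+1} | padded_index k (L - d + k) l)
  tens Gd (split_factor k (x l) v v).
have -> : tens Gd v = Pk 0%N.
  rewrite /Pk (big_pred1 [ffun=> ord0]) => [|l].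
    by congr tens; apply/functional_extensionality_dep => n;
      rewrite /split_factor ltn0 if_same.
  rewrite /padded_index /=; apply/idP/eqP => [/andP[/forallP l0 _]|->]; last first.
    apply/andP; split; first by apply/forallP => n; rewrite ffunE.
    by rewrite big1// => n _; rewrite ffunE.
  by apply/ffunP => n; apply/val_inj; move: (l0 n); rewrite ffunE /=;
    case: (nat_of_ord (l n)).
have -> : \sum_(l : {ffun 'I_d -> 'I_L.+1} |
      [forall n, 0 < l n]%N && (\sum_(n < d) l n <= L)%N)
    tens Gd (fun n => u n (l n) - u n (l n).-1) = Pk d.
  apply: eq_big => [l|l _].
    rewrite /padded_index subnK//; congr andb.
    by apply/eq_forallb => n; rewrite ltn_ord eqb_id.
  by congr tens; apply/functional_extensionality_dep => n;
    rewrite /split_factor ltn_ord.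
rewrite -opprB -telescope_sumr// big_mkord -sumrN; apply: eq_bigr => k _.
rewrite opprB /Pk addnS big_padded_indexS -sumrB; apply: eq_bigr => l lk.
pose f := split_factor k (x l) v v.
have upd (y : G k) : tens Gd (dfwith f k y) =
    tens Gd (split_factor k (x l) (dfwith f k y) v).
  congr tens; apply/functional_extensionality_dep => n.
  rewrite /split_factor; case: (ltngtP n k) => nk.
  - by rewrite dfwithout ?/f /split_factor ?nk// -val_eqE /= gtn_eqF.
  - by rewrite dfwithout ?/f /split_factor ?(ltn_eqF nk) 1?ltnNge ?(ltnW nk)//
      ?(gtn_eqF nk)// -val_eqE /= ltn_eqF.
  - by [].
have -> : tens Gd (split_factor k (x l) v v) = tens Gd (dfwith f k (v k)).
  congr tens; apply/functional_extensionality_dep => n.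
  by case: dfwithP => //; rewrite /split_factor ltnn eqxx.
(* Since k < d, the admissible entries t never exceed L, so the index type ['I_L.+1] truncates no
   sum. *)
have M_le : ((L - d + k).+1 <= L)%N by rewrite -addnS -leq_subRL ?leq_subr// subKn.
pose K := ((L - d + k).+1 - \sum_m l m)%N.
have lk0 : l k = ord0.
  apply/val_inj => /=; move: lk => /andP[/forallP/(_ k)]; rewrite ltnn.
  by case: (nat_of_ord (l k)).
rewrite (eq_bigr (fun t : 'I_L.+1 => tens Gd (dfwith f k (u k t - u k t.-1))));
  last first.
  move=> t _; congr tens; apply/functional_extensionality_dep => n.
  case: dfwithP => [|{}n nk]; first by rewrite /split_factor ltnSn /x ffunE eqxx.
  rewrite /f /split_factor ltnS leq_eqVlt [nat_of_ord n == k]val_eqE.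
  by rewrite eq_sym (negPf nk) /x ffunE eq_sym (negPf nk) if_same.
rewrite tens_dfwith_sum tens_dfwithB.
rewrite (@big_shifted_range _ _ _ _ (fun t => u k t - u k t.-1))// -/K.
rewrite big_add1 /= telescope_sumr// u0 subr0 upd.
congr tens; apply/functional_extensionality_dep => n; rewrite /split_factor.
case: ltnP => // _; case: eqP => // /val_inj ->.
by rewrite dfwithin.
Qed.

End telescoping.

(** * Measurability and integration *)

Section measurability.
Context (R : realType).

Lemma measurable_fun_gt disp (T : measurableType disp) (g : T -> R) :
  (forall r, measurable [set w | r < g w]) -> measurable_fun setT g.
Proof.
move=> mg mT; apply: (measurability _ (RGenOInfty.measurableE R)) => //.
move=> _ [_ [r ->] <-]; rewrite setTI.
suff -> : g @^-1` `]r, +oo[%classic = [set w | r < g w] by [].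
by apply/seteqP; split=> w /=; rewrite in_itv /= andbT.
Qed.

Lemma separable_sequence (V : normedModType R) : separable V ->
  exists a : nat -> V, dense (range a).
Proof.
move=> [A /countable_injP[f injf] dA].
exists (fun n => xget 0 [set x | A x /\ f x = n]) => O O0 oO.
have [x [Ox Ax]] := dA O O0 oO; exists x; split=> //; exists (f x) => //.
by case: xgetP => [y _ [Ay fyx]|/(_ x)[]//]; apply: injf => //; exact/mem_set.
Qed.

(* ||x - y|| is the supremum of ||x - a|| - ||y - a|| over a dense set of
   points a, which reduces measurability to that of distances to fixed points. *)
Lemma measurable_normB disp (Om : measurableType disp) (G : normedModType R)
    (X Y : Om -> G) : separable G -> Defs.random_variable X ->
      Defs.random_variable Y ->
  measurable_fun setT (fun w => `|X w - Y w|).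
Proof.
move=> /separable_sequence[a da] mX mY.
have dist Z (n : nat) : Defs.random_variable Z ->
  measurable_fun setT (fun w => `|Z w - a n|).
  move=> mZ; apply: measurable_fun_gt => r.
  rewrite -[X in measurable X]setTI.
  apply: (mZ measurableT [set y : G | r < `|y - a n|]).
  apply: sub_sigma_algebra.
  apply: (@open_comp _ _ (fun y : G => `|y - a n|) [set s | r < s]);
    last exact: open_gt.
  move=> y _; apply: cvg_norm; apply: cvgB; [exact: cvg_id|exact: cvg_cst].
apply: measurable_fun_gt => r.
have -> : [set w | r < `|X w - Y w|] =
    \bigcup_n [set w | r < `|X w - a n| - `|Y w - a n|].
  apply/seteqP; split=> [w /= rXY|w [n _ /=] rn]; last first.
    apply: lt_le_trans rn _; rewrite lerBlDr.
    by rewrite -[X w - a n](subrKA (Y w)) ler_normD.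
  have e0 : 0 < (`|X w - Y w| - r) / 2 by rewrite divr_gt0// subr_gt0.
  have [_ [n _ <-]] := dense_ball (Y w) da e0; move=> Yan; exists n => //=.
  have : `|X w - Y w| <= `|X w - a n| + `|Y w - a n|.
    by rewrite -[X w - Y w](subrKA (a n)) (le_trans (ler_normD _ _))// (distrC (a n)).
  lra.
apply: bigcup_measurable => n _.
have -> : [set w | r < `|X w - a n| - `|Y w - a n|] =
    (fun w => `|X w - a n| - `|Y w - a n|) @^-1` `]r, +oo[%classic.
  by apply/seteqP; split=> w /=; rewrite in_itv /= andbT.
rewrite -[X in measurable X]setTI.
have mf : measurable_fun setT (fun w => `|X w - a n| - `|Y w - a n|).
  by apply: measurable_funB; exact: dist.
by apply: mf => //; exact: measurable_itv.
Qed.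

Lemma random_variable_cst disp (Om : measurableType disp) (G : normedModType R)
  (x : G) : Defs.random_variable (fun _ : Om => x).
Proof. exact: measurable_cst. Qed.

End measurability.

Section integration.
Context disp (T : measurableType disp) (R : realType) (mu : measure T R).
Local Open Scope ereal_scope.

(** The integral of a nonnegative function is a supremum over simple functions below it, hence
    monotone without measurability. This matters for suprema over the unit ball and for squared
    norms of sums of random operators. *)
Lemma le_integral_ge0 (f g : T -> \bar R) :
  (forall x, 0 <= f x) -> (forall x, f x <= g x) ->
  \int[mu]_x f x <= \int[mu]_x g x.
Proof.
move=> f0 fg; have g0 x : 0 <= g x by exact: le_trans (fg x).
rewrite !ge0_integralTE//; apply: le_ereal_sup => _ [h hf <-]; exists h => // x.
exact: le_trans (hf x) (fg x).
Qed.

Lemma sqrte_le (x : \bar R) (c : R) : (0 <= c)%R -> x <= (c ^+ 2)%:E ->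
  sqrte x <= c%:E.
Proof.
move=> c0 xc; have -> : c%:E = sqrte ((c ^+ 2)%:E).
  by rewrite EFin_expe sqrte_sqr gee0_abs.
by rewrite lee_sqrt// lee_fin sqr_ge0.
Qed.

Lemma le_sqrte (x : \bar R) (c : R) : 0 <= x -> sqrte x <= c%:E ->
  x <= (c ^+ 2)%:E.
Proof.
move=> x0 xc; rewrite -(sqr_sqrte x0) EFin_expe.
by rewrite lee_sqr// ?sqrte_ge0// (le_trans _ xc)// sqrte_ge0.
Qed.

End integration.

(** Extends a claim from families with every member in a small class s to families in a larger class
    t, one coordinate at a time. In the induction the coordinates from k on still lie in s. *)
Lemma dfwith_induction (d : nat) (V : 'I_d -> Type) (s t : forall n, V n -> Prop)
    (Q : (forall n, V n) -> Prop) :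
  (forall n x, s n x -> t n x) ->
  (forall f, (forall n, s n (f n)) -> Q f) ->
  (forall f n, (forall m, t m (f m)) ->
    (forall x, s n x -> Q (dfwith f n x)) -> Q f) ->
  forall f, (forall n, t n (f n)) -> Q f.
Proof.
move=> st Qs Qt f tf.
suff gen k : (k <= d)%N -> forall f, (forall n, t n (f n)) ->
    (forall n : 'I_d, (k <= n)%N -> s n (f n)) -> Q f.
  by apply: (gen d) => // n; rewrite leqNgt ltn_ord.
elim: k => [_ g _ sg|k IHk kd g tg sg]; first by apply: Qs => n; exact: sg.
apply: (Qt _ (Ordinal kd)) => // x sx; apply: IHk => [|n|n]; first exact: ltnW.
  by case: dfwithP => // ; exact: st.
case: dfwithP => // n' n'k kn; apply: sg; rewrite ltn_neqAle kn andbT.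
by move: n'k; rewrite -val_eqE.
Qed.

(** * Integrals of products over independent coordinates *)

Section product_integral.
Context (R : realType).
Import HBNNSimple.

(** The image under [phi] of the measure with density [h] agrees with c times [m1] on measurable
    sets, hence on nonnegative functions, by simple functions and monotone convergence. With [phi] a
    coordinate and [h] the product of the other factors, this frees one coordinate from being an
    indicator. *)
Lemma ge0_integral_comp_mul d1 d2 (T1 : measurableType d1) (T2 : measurableType d2)
    (m1 : measure T1 R) (m2 : measure T2 R) (phi : T2 -> T1) (h : T2 -> R) (c : R) :
  measurable_fun setT phi -> measurable_fun setT h -> (forall y, 0 <= h y) ->
  0 <= c ->
  (forall A, measurable A -> \int[m2]_y (\1_A (phi y) * h y)%:E = m1 A * c%:E)%E ->
  forall g : T1 -> R, measurable_fun setT g -> (forall x, 0 <= g x) ->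
  (\int[m2]_y (g (phi y) * h y)%:E = \int[m1]_x (g x)%:E * c%:E)%E.
Proof.
move=> mphi mh h0 c0 Hind g mg g0.
have mul_h (f : T1 -> R) : measurable_fun setT f ->
    measurable_fun setT (fun y => (f (phi y) * h y)%:E).
  by move=> mf; apply/measurable_EFinP; apply: measurable_funM => //;
    exact: measurableT_comp.
pose f_ := nnsfun_approx measurableT ((measurable_EFinP _ _).2 mg).
have f_g x : (EFin \o f_ ^~ x) n @[n --> \oo] --> (g x)%:E.
  by apply: (cvg_nnsfun_approx measurableT ((measurable_EFinP _ _).2 mg)) =>
    // y _; rewrite lee_fin.
have f_nd x m n : (m <= n)%N -> f_ m x <= f_ n x.
  by move=> mn; exact/lefP/nd_nnsfun_approx.
have lim1 : (\int[m1]_x (f_ n x)%:E @[n --> \oo] --> \int[m1]_x (g x)%:E)%E.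
  have -> : (\int[m1]_x (g x)%:E = \int[m1]_x limn (fun n => (f_ n x)%:E))%E.
    by apply: eq_integral => x _; apply/esym/cvg_lim => //; exact: f_g.
  apply: cvg_monotone_convergence => //.
  - by move=> n; exact/measurable_EFinP/measurable_funP.
  - by move=> n x _; rewrite lee_fin.
  - by move=> x _ m n mn; rewrite lee_fin f_nd.
have lim2 : (\int[m2]_y (f_ n (phi y) * h y)%:E @[n --> \oo] -->
    \int[m2]_y (g (phi y) * h y)%:E)%E.
  have -> : (\int[m2]_y (g (phi y) * h y)%:E =
      \int[m2]_y limn (fun n => (f_ n (phi y) * h y)%:E))%E.
    apply: eq_integral => y _; apply/esym/cvg_lim => //.
    under eq_fun do rewrite EFinM; rewrite EFinM.
    by apply: cvgeZr => //; exact: f_g.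
  apply: cvg_monotone_convergence => //.
  - by move=> n; apply: mul_h; exact: measurable_funP.
  - by move=> n y _; rewrite lee_fin mulr_ge0.
  - by move=> y _ m n mn; rewrite lee_fin ler_wpM2r// f_nd.
suff E1 n : (\int[m2]_y (f_ n (phi y) * h y)%:E = \int[m1]_x (f_ n x)%:E * c%:E)%E.
  have cfin : c%:E \is a fin_num by [].
  move: lim2; rewrite (funext E1) => lim2.
  exact: (cvg_unique _ lim2 (cvgeZr cfin lim1)).
move: (f_ n) => f {f_ f_g f_nd lim1 lim2}.
have m1f r : measurable (f @^-1` [set r]).
  by rewrite -[X in measurable X]setTI; exact: measurable_funP.
have mi r : measurable_fun setT (\1_(f @^-1` [set r]) : T1 -> R).
  exact: measurable_indic.
have rgt0 r x : (f @^-1` [set r]) x -> 0 <= r by move=> <-.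
have ge0i r x : 0 <= r * \1_(f @^-1` [set r]) x by exact: nnfun_muleindic_ge0.
have int r : (\int[m2]_y (r * \1_(f @^-1` [set r]) (phi y) * h y)%:E =
    \int[m1]_x (r * \1_(f @^-1` [set r]) x)%:E * c%:E)%E.
  have [r0|r0] := leP 0 r.
    under eq_integral do rewrite -mulrA EFinM.
    rewrite ge0_integralZl//; last 2 first.
    - exact: (mul_h (\1_(f @^-1` [set r]) : T1 -> R)).
    - by move=> y _; rewrite lee_fin mulr_ge0// indicE.
    under [in RHS]eq_integral do rewrite EFinM.
    rewrite [in RHS]ge0_integralZl//; last exact/measurable_EFinP.
    by rewrite integral_indic// setIT Hind// muleA.
  have -> : f @^-1` [set r] = set0 by exact: preimage_nnfun0.
  by rewrite !integral0_eq ?mul0e// => x _; rewrite indic0 ?mulr0 ?mul0r.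
transitivity (\sum_(r \in range f)
    \int[m2]_y (r * \1_(f @^-1` [set r]) (phi y) * h y)%:E)%E.
  rewrite -ge0_integral_fsum//.
  - apply: eq_integral => y _; rewrite fsumEFin// fimfunE.
    by congr EFin; rewrite mulr_fsuml.
  - by move=> r; apply: (mul_h (fun x => r * \1_(f @^-1` [set r]) x));
      exact: measurable_funM.
  - by move=> r y _; rewrite lee_fin mulr_ge0.
transitivity (\sum_(r \in range f)
    \int[m1]_x (r * \1_(f @^-1` [set r]) x)%:E * c%:E)%E.
  by apply: eq_fsbigr => r _; exact: int.
rewrite -ge0_mule_fsuml//; last first.
  by move=> r; apply: integral_ge0 => x _; rewrite lee_fin.
congr (_ * _)%E; rewrite -ge0_integral_fsum//.
- by apply: eq_integral => x _; rewrite fsumEFin// -fimfunE.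
- by move=> r; exact/measurable_EFinP/measurable_funM.
- by move=> r x _; rewrite lee_fin.
Qed.

Context (d : nat) (disp : 'I_d -> measure_display)
  (Om : forall n, measurableType (disp n))
  (P : forall n, probability (Om n) R) (PP : probability (product_space Om) R)
  (hPP : is_product_probability P PP).

Lemma measurable_coordinate n :
  measurable_fun setT (fun w : product_space Om => w n).
Proof.
move=> _ A mA; rewrite setTI; apply: sub_sigma_algebra.
by exists n => //; exists A => //; rewrite setTI.
Qed.

Lemma measurable_prod_coordinates (Q : pred 'I_d) (g : forall n, Om n -> R) :
  (forall n, measurable_fun setT (g n)) ->
  measurable_fun setT (fun w : product_space Om => \prod_(n | Q n) g n (w n)).
Proof.
move=> mg; have -> : (fun w : product_space Om => \prod_(n | Q n) g n (w n)) =
    fun w => \prod_n (if Q n then g n (w n) else 1).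
  by apply/funext => w; rewrite big_mkcond.
apply: measurable_prod => n _; case: (Q n) => //.
by apply: measurableT_comp (mg n) _; exact: measurable_coordinate.
Qed.

Lemma prod_dfwith (g : forall n, Om n -> R) n (x : Om n -> R)
    (w : forall n, Om n) :
  \prod_m dfwith g n x m (w m) = x (w n) * \prod_(m | m != n) g m (w m).
Proof.
rewrite (bigD1 n)//= dfwithin; congr (_ * _).
by apply: eq_bigr => m mn; rewrite dfwithout// eq_sym.
Qed.

Lemma prod_Rintegral_dfwith (g : forall n, Om n -> R) n (x : Om n -> R) :
  \prod_m (\int[P m]_w dfwith g n x m w) =
  (\int[P n]_w x w) * \prod_(m | m != n) \int[P m]_w g m w.
Proof.
rewrite (bigD1 n)//= dfwithin; congr (_ * _).
by apply: eq_bigr => m mn; rewrite dfwithout// eq_sym.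
Qed.

Lemma dfwith_id (g : forall n, Om n -> R) n : dfwith g n (g n) = g.
Proof. by apply/functional_extensionality_dep => m; case: dfwithP. Qed.

Lemma fine_Rintegral disp' (T' : measurableType disp') (mu : measure T' R)
    (g : T' -> R) : mu.-integrable setT (EFin \o g) ->
  (\int[mu]_x (g x)%:E)%E = (\int[mu]_x g x)%:E.
Proof. by move=> ig; rewrite fineK//; exact: integrable_fin_num. Qed.

(** The product measure is prescribed on rectangles, which settles products of indicators; the
    factors are then generalized coordinate by coordinate. *)
Lemma ge0_integral_prod_coordinates (g : forall n, Om n -> R) :
  (forall n, (P n).-integrable setT (EFin \o g n)) ->
  (forall n x, 0 <= g n x) ->
  (\int[PP]_w (\prod_n g n (w n))%:E)%E = (\prod_n \int[P n]_x g n x)%:E.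
Proof.
move=> ig g0; have : forall n, (P n).-integrable setT (EFin \o g n) /\ forall
  x, 0 <= g n x.
  by move=> n; split; [exact: ig|exact: g0].
move: g {ig g0}; apply: (@dfwith_induction d (fun n => Om n -> R)
  (fun n f => exists2 A, measurable A & f = \1_A :> (Om n -> R))
  (fun n f => (P n).-integrable setT (EFin \o f) /\ forall x, 0 <= f x)
  (fun g => \int[PP]_w (\prod_n g n (w n))%:E = (\prod_n \int[P n]_x g n x)%:E)%E).
- move=> n _ [A mA ->]; split=> [|x]; last by rewrite indicE.
  by apply: integrable_indic => //; rewrite setIT; exact: fin_num_fun_lty.
- move=> g Hg; pose A n := projT1 (cid2 (Hg n)).
  have [mA gA] : (forall n, measurable (A n)) /\ forall n, g n = \1_(A n).
    by split=> n; rewrite /A; case: cid2.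
  have -> : (\int[PP]_w (\prod_n g n (w n))%:E =
      \int[PP]_w (\1_[set w : product_space Om | forall n, A n (w n)] w)%:E)%E.
    apply: eq_integral => w _; congr EFin.
    rewrite indicE; case: (boolP (w \in _)) => [|/negP wA].
      by rewrite inE /= => wA; rewrite big1// => n _; rewrite gA indicE mem_set.
    have /existsNP[n wn] : ~ forall n, A n (w n) by move=> wA'; apply: wA;
      rewrite inE.
    by rewrite (bigD1 n)//= gA indicE memNset// mul0r.
  rewrite integral_indic//; last first.
    have -> : [set w : product_space Om | forall n, A n (w n)] =
        \bigcap_n ((fun w : product_space Om => w n) @^-1` A n).
      by apply/seteqP; split=> w /= wA n; [move=> _; exact: wA|exact: (wA n I)].
    apply: fin_bigcap_measurable => // n _; rewrite -[X in measurable X]setTI.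
    exact: measurable_coordinate.
  rewrite setIT; transitivity (\prod_n P n (A n))%E; first exact: hPP.
  rewrite -prodEFin; apply: eq_bigr => n _.
  by rewrite gA /Rintegral integral_indic// setIT fineK// fin_num_measure.
- move=> g n Hg ind; rewrite -(dfwith_id g n) prod_Rintegral_dfwith.
  under eq_integral do rewrite prod_dfwith.
  have mg m : measurable_fun setT (g m).
    by apply/measurable_EFinP; have [/measurable_int] := Hg m.
  rewrite EFinM -fine_Rintegral//; last exact: (Hg n).1.
  apply: ge0_integral_comp_mul (mg n) (Hg n).2.
  + exact: measurable_coordinate.
  + exact: measurable_prod_coordinates.
  + by move=> w; apply: prodr_ge0 => m _; exact: (Hg m).2.
  + by apply: prodr_ge0 => m _; apply: Rintegral_ge0 => x _; exact: (Hg m).2.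
  move=> A mA; have := ind \1_A (ex_intro2 _ _ A mA erefl).
  rewrite prod_Rintegral_dfwith EFinM /Rintegral integral_indic// setIT fineK
    ?fin_num_measure// => <-.
  by apply: eq_integral => w _; rewrite prod_dfwith.
Qed.

(** The signed case is required for the inner products in Gram matrices. Both sides are additive in
    each factor, so each factor splits into positive and negative parts. *)
Lemma integral_prod_coordinates (g : forall n, Om n -> R) :
  (forall n, (P n).-integrable setT (EFin \o g n)) ->
  PP.-integrable setT (EFin \o fun w => \prod_n g n (w n)) /\
  \int[PP]_w (\prod_n g n (w n)) = \prod_n \int[P n]_x g n x.
Proof.
move: g; apply: (@dfwith_induction d (fun n => Om n -> R)
  (fun n f => (P n).-integrable setT (EFin \o f) /\ forall x, 0 <= f x)
  (fun n f => (P n).-integrable setT (EFin \o f))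
  (fun g => PP.-integrable setT (EFin \o fun w => \prod_n g n (w n)) /\
    \int[PP]_w (\prod_n g n (w n)) = \prod_n \int[P n]_x g n x)).
- by move=> n f [].
- move=> g Hg; have E := ge0_integral_prod_coordinates (fun n => (Hg n).1)
    (fun n => (Hg n).2).
  split; last by rewrite /Rintegral E.
  apply/integrableP; split.
    apply/measurable_EFinP; apply: measurable_prod_coordinates => n.
    by apply/measurable_EFinP; have [/measurable_int] := Hg n.
  have -> : (\int[PP]_w `|(EFin \o (fun w => \prod_n g n (w n))%R) w| =
      \int[PP]_w (\prod_n g n (w n))%R%:E)%E.
    apply: eq_integral => w _; rewrite gee0_abs// lee_fin.
    by apply: prodr_ge0 => n _; exact: (Hg n).2.
  by rewrite E ltry.
- move=> g n ig ind.
  have gE : g n = fun x => (g n)^\+ x - (g n)^\- x by rewrite -[LHS]funrposBneg.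
  have ip : (P n).-integrable setT (EFin \o (g n)^\+) by exact: integrable_funrpos.
  have iN : (P n).-integrable setT (EFin \o (g n)^\-) by exact: integrable_funrneg.
  have [i1 E1] := ind _ (conj ip (funrpos_ge0 (g n))).
  have [i2 E2] := ind _ (conj iN (funrneg_ge0 (g n))).
  have prodE w : \prod_m g m (w m) = \prod_m dfwith g n (g n)^\+ m (w m) -
      \prod_m dfwith g n (g n)^\- m (w m).
    rewrite -{1}(dfwith_id g n) !prod_dfwith {1}gE; ring.
  split.
    apply: eq_integrable (integrableB _ i1 i2) => // w _ /=.
    by rewrite prodE EFinB.
  transitivity (\int[PP]_w (\prod_m dfwith g n (g n)^\+ m (w m) -
      \prod_m dfwith g n (g n)^\- m (w m))).
    by apply: eq_Rintegral => w _; exact: prodE.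
  rewrite RintegralB// E1 E2 -[in RHS](dfwith_id g n) !prod_Rintegral_dfwith -mulrBl.
  by rewrite -RintegralB// {3}gE.
Qed.

End product_integral.

(** * Root mean square bounds *)

Section rms_le.
Context (R : realType).

(* In the worst case setting a measurable majorant nu replaces the supremum over
   the unit ball, whose measurability would need separability of the domain. *)
Definition rms_le (x : setting) disp (Om : measurableType disp)
    (P : probability Om R) (F G : normedModType R) (c : R) (T : Om -> F -> G) :=
  [/\ forall w, bounded_operator (T w),
      forall f, measurable_fun setT (fun w => `|T w f| ^+ 2) &
      match x with
      | Randomized => forall f,
          (\int[P]_w (`|T w f| ^+ 2)%:E <= (c ^+ 2 * `|f| ^+ 2)%:E)%E
      | WorstCase => exists nu : Om -> R,
          [/\ measurable_fun setT nu, forall w, 0 <= nu w,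
              forall w f, `|T w f| ^+ 2 <= nu w * `|f| ^+ 2 &
              (\int[P]_w (nu w)%:E <= (c ^+ 2)%:E)%E]
      end].

Lemma normalize_norm (V : normedModType R) (v : V) : v != 0 -> `|(`|v|^-1 *: v)| = 1.
Proof. by move=> v0; rewrite normrZ normfV normr_id mulVf ?normr_eq0. Qed.

Lemma normalizeK (V : normedModType R) (v : V) : v = `|v| *: (`|v|^-1 *: v).
Proof.
have [->|v0] := eqVneq v 0; first by rewrite !scaler0.
by rewrite scalerA divff ?scale1r ?normr_eq0.
Qed.

Section norm_bound.
Context disp (Om : measurableType disp) (P : probability Om R)
  (F G : normedModType R) (c : R) (T : Om -> F -> G).
Hypotheses (bT : forall w, bounded_operator (T w))
  (mT : forall f, measurable_fun setT (fun w => `|T w f| ^+ 2)).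

Lemma randomized_rms_le : (rms_norm P Randomized T <= c%:E)%E ->
  rms_le Randomized P c T.
Proof.
move=> Tc; split=> // f; have [->|f0] := eqVneq f 0.
  rewrite integral0_eq ?normr0 ?expr0n ?mulr0// => w _.
  by have [-> _ _ _] := linear_opP (proj1 (bT w)); rewrite normr0 expr0n.
have TE w : (`|T w f| ^+ 2)%:E =
    ((`|f| ^+ 2)%:E * (`|T w (`|f|^-1 *: f)| ^+ 2)%:E)%E.
  have [_ _ _ TZ] := linear_opP (proj1 (bT w)).
  by rewrite {1}(normalizeK f) TZ normrZ normr_id exprMn EFinM.
under eq_integral do rewrite TE.
rewrite ge0_integralZl//; last exact/measurable_EFinP.
rewrite [(c ^+ 2 * _)%R]mulrC [in leRHS]EFinM.
apply: lee_wpmul2l; first by rewrite lee_fin sqr_ge0.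
apply: le_sqrte => //.
  by apply: integral_ge0 => w _; rewrite lee_fin sqr_ge0.
apply: le_trans Tc; apply: ereal_sup_ubound; exists (`|f|^-1 *: f) => //=.
by rewrite normalize_norm.
Qed.

(* The least admissible nu is the squared operator norm, computed as a supremum
   over a dense sequence so that it is measurable. *)
Lemma worst_case_rms_le : separable F -> (rms_norm P WorstCase T <= c%:E)%E ->
  rms_le WorstCase P c T.
Proof.
move=> /separable_sequence[a da] Tc; split=> //.
(* At [a n = 0] the quotient is 0 by the convention for division by zero, in accordance with T 0 =
   0. *)
pose q w n := `|T w (a n)| ^+ 2 / `|a n| ^+ 2.
have ubq w : has_ubound (range (q w)).
  have /bounded_operatorP[_ [M M0 TM]] := bT w.
  exists (M ^+ 2) => _ [n _ <-]; rewrite /q; have [->|an0] := eqVneq (a n) 0.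
    by rewrite normr0 expr0n invr0 mulr0 sqr_ge0.
  rewrite ler_pdivrMr ?exprn_gt0 ?normr_gt0// -exprMn.
  by rewrite lerXn2r ?nnegrE ?mulr_ge0.
have q0 w n : 0 <= q w n by rewrite divr_ge0 ?sqr_ge0.
have le_q w n : q w n <= sup (range (q w)) by apply: ub_le_sup => //; exists n.
exists (fun w => sup (range (q w))); split.
- apply: measurable_fun_gt => r.
  have -> : [set w | r < sup (range (q w))] = \bigcup_n [set w | r < q w n].
    apply/seteqP; split=> [w /= /sup_gt[|_ [n _ <-] rq]|w [n _ /=] rq].
    + by exists (q w 0%N); exists 0%N.
    + by exists n.
    + exact: lt_le_trans (le_q w n).
  apply: bigcup_measurable => n _.
  have -> : [set w | r < q w n] = (q ^~ n) @^-1` `]r, +oo[%classic.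
    by apply/seteqP; split=> w /=; rewrite in_itv /= andbT.
  rewrite -[X in measurable X]setTI; apply: measurable_funM => //.
- by move=> w; apply: le_trans (le_q w 0%N).
- move=> w f; rewrite -subr_ge0.
  apply: (@dense_closed _ _ (range a) [set f | 0 <= sup (range (q w)) * `|f| ^+ 2 -
    `|T w f| ^+ 2]) => //.
    apply: (@preimage_closed _ _ (fun f => sup (range (q w)) * `|f| ^+ 2 -
      `|T w f| ^+ 2) [set r | 0 <= r]); last exact: closed_ge.
    move=> y _; apply: cvgB.
      by apply: cvgMr; apply: cvg_sqr; exact: norm_continuous.
    by apply: cvg_sqr; apply: cvg_norm; exact: (proj2 (bT w)).
  move=> _ [n _ <-] /=; rewrite subr_ge0; have [an0|an0] := eqVneq (a n) 0.
    have [T0 _ _ _] := linear_opP (proj1 (bT w)).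
    by rewrite an0 T0 !normr0 expr0n mulr0.
  by rewrite -ler_pdivrMr ?exprn_gt0 ?normr_gt0//; exact: le_q.
- apply: (@le_trans _ _ (\int[P]_w
      ereal_sup [set (`|T w f| ^+ 2)%:E | f in
        [set f : F | (`|f| <= 1)%R]])%E); last first.
    apply: le_sqrte => //; apply: integral_ge0 => w _.
    apply: (@le_trans _ _ (`|T w 0| ^+ 2)%:E); first by rewrite lee_fin sqr_ge0.
    by apply: ereal_sup_ubound; exists 0 => //=; rewrite normr0.
  apply: le_integral_ge0 => w; first by rewrite lee_fin (le_trans _ (le_q w 0%N)).
  set S := ereal_sup _.
  have qS n : ((q w n)%:E <= S)%E.
    have [_ _ _ TZ] := linear_opP (proj1 (bT w)).
    have -> : q w n = `|T w (`|a n|^-1 *: a n)| ^+ 2.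
      by rewrite TZ normrZ normfV normr_id exprMn exprVn mulrC.
    apply: ereal_sup_ubound; exists (`|a n|^-1 *: a n) => //=.
    have [->|an0] := eqVneq (a n) 0; first by rewrite scaler0 normr0.
    by rewrite normalize_norm.
  case: S qS => [s|_|/(_ 0%N)]; rewrite ?leey ?leeNy_eq// => qs.
  rewrite lee_fin; apply: ge_sup; first by exists (q w 0%N); exists 0%N.
  by move=> _ [n _ <-]; rewrite -lee_fin.
Qed.

Lemma rms_norm_rms_le x : separable F -> (rms_norm P x T <= c%:E)%E ->
  rms_le x P c T.
Proof.
by case: x => sF; [exact: randomized_rms_le|exact: worst_case_rms_le].
Qed.

End norm_bound.

Lemma operator_norm_le (F G : normedModType R) (S : F -> G) (B : R) f :
  linear S -> (operator_norm S <= B%:E)%E -> `|S f| <= B * `|f|.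
Proof.
move=> lS SB; have [S0 _ _ SZ] := linear_opP lS.
have [->|f0] := eqVneq f 0; first by rewrite S0 !normr0 mulr0.
rewrite {1}(normalizeK f) SZ normrZ normr_id mulrC ler_wpM2r//.
rewrite -lee_fin; apply: le_trans SB; apply: ereal_sup_ubound.
by exists (`|f|^-1 *: f) => //=; rewrite normalize_norm.
Qed.

Lemma rms_le_cst x disp (Om : measurableType disp) (P : probability Om R)
    (F G : normedModType R) (S : F -> G) (B : R) :
  0 <= B -> bounded_operator S -> (operator_norm S <= B%:E)%E ->
  rms_le x P B (fun=> S).
Proof.
move=> B0 bS SB; have Sf f : `|S f| ^+ 2 <= B ^+ 2 * `|f| ^+ 2.
  rewrite -exprMn lerXn2r ?nnegrE ?mulr_ge0//.
  exact: operator_norm_le (proj1 bS) SB.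
split=> //; case: x => [f|].
  by rewrite integral_cst// [X in (_ * X)%E](probability_setT P) mule1 lee_fin.
exists (cst (B ^+ 2)); split=> //.
- by move=> w; exact: sqr_ge0.
- rewrite (integral_cst P measurableT (B ^+ 2)%:E).
  by rewrite [X in (_ * X)%E](probability_setT P) mule1.
Qed.

End rms_le.

Section Rintegral_sums.
Context disp (T : measurableType disp) (R : realType) (mu : measure T R).

Lemma Rintegral_sum (I : Type) (r : seq I) (g : I -> T -> R) :
  (forall i, mu.-integrable setT (EFin \o g i)) ->
  mu.-integrable setT (EFin \o fun x => \sum_(i <- r) g i x) /\
  \int[mu]_x (\sum_(i <- r) g i x) = \sum_(i <- r) \int[mu]_x g i x.
Proof.
move=> ig; elim: r => [|i r [ir Er]].
  have -> : (fun x => \sum_(i <- [::]) g i x) = fun=> 0.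
    by apply/funext => x; rewrite big_nil.
  by split; [exact: integrable0|rewrite Rintegral_cst// mul0r big_nil].
have -> : (fun x => \sum_(i <- i :: r) g i x) = fun x => g i x + \sum_(j <- r) g j x.
  by apply/funext => x; rewrite big_cons.
split; first by apply: eq_integrable (integrableD measurableT (ig i) ir).
by rewrite RintegralD// Er big_cons.
Qed.

Lemma Rintegral_quadratic_form (I : finType) (M : T -> I -> I -> R) (a : I -> R) :
  (forall i k, mu.-integrable setT (EFin \o fun x => M x i k)) ->
  mu.-integrable setT (EFin \o fun x => quadratic_form (M x) a) /\
  \int[mu]_x quadratic_form (M x) a =
    quadratic_form (fun i k => \int[mu]_x M x i k) a.
Proof.
move=> iM.
have iaM i k : mu.-integrable setT (EFin \o fun x => a i * a k * M x i k).
  exact: integrableZl (iM i k).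
have [_ E1] := (Rintegral_sum (index_enum I)
  (fun i => (Rintegral_sum (index_enum I) (iaM i)).1)).
split; first exact: (Rintegral_sum _ (fun i => (Rintegral_sum _ (iaM i)).1)).1.
rewrite E1; apply: eq_bigr => i _; rewrite (Rintegral_sum _ (iaM i)).2.
by apply: eq_bigr => k _; rewrite RintegralZl.
Qed.

(** Passes second moment bounds from approximating tensor sums to their limit, where no integrable
    majorant is at hand. *)
Lemma fatou_le (u : nat -> T -> R) (g : T -> R) (v : nat -> R) (l : R) :
  (forall k, measurable_fun setT (u k)) -> (forall k x, 0 <= u k x) ->
  (forall x, u k x @[k --> \oo] --> g x) ->
  (forall k, (\int[mu]_x (u k x)%:E <= (v k)%:E)%E) ->
  v k @[k --> \oo] --> l -> (\int[mu]_x (g x)%:E <= l%:E)%E.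
Proof.
move=> mu_ u0 ug uv vl.
have ug' x : (u k x)%:E @[k --> \oo] --> (g x)%:E by apply: cvg_EFin;
  [exact: nearW|exact: ug].
have vl' : (v k)%:E @[k --> \oo] --> l%:E by apply: cvg_EFin;
  [exact: nearW|exact: vl].
have -> : (\int[mu]_x (g x)%:E = \int[mu]_x limn_einf (fun k => (u k x)%:E))%E.
  by apply: eq_integral => x _; rewrite (cvg_limn_einf_sup (ug' x)).1.
apply: le_trans (fatou mu measurableT _ _) _.
- by move=> k; exact/measurable_EFinP.
- by move=> k x _; rewrite lee_fin.
rewrite limn_einf_lim -(cvg_lim _ vl')//; apply: lee_lim.
- exact: is_cvg_einfs.
- by apply/cvg_ex; exists l%:E.
- apply: nearW => k; apply: le_trans (uv k).
  by apply: ereal_inf_lbound; exists k => /=.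
Qed.

End Rintegral_sums.

(** * Second moments of tensor products of random operators *)

Section tensor_rms.
Context (R : realType) (d : nat) (F G : 'I_d -> hilbertType R)
  (Fd : hilbert_tensor F) (Gd : hilbert_tensor G)
  (disp : 'I_d -> measure_display) (Om : forall n, measurableType (disp n))
  (P : forall n, probability (Om n) R) (PP : probability (product_space Om) R)
  (hPP : is_product_probability P PP)
  (T : forall n, Om n -> F n -> G n) (c : 'I_d -> R).
Arguments T : clear implicits.
Hypotheses (bT : forall n w, bounded_operator (T n w))
  (mT : forall n f, measurable_fun setT (fun w => `|T n w f| ^+ 2)).
Arguments bT : clear implicits.
Arguments mT : clear implicits.

Let TT (w : product_space Om) := tensor_operator Fd Gd (fun n => T n (w n)).

Let bTT w : bounded_operator (TT w).
Proof. by apply: (tensor_operatorP Fd Gd _).1 => n; exact: bT. Qed.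

Let dotE n f f' w : hdot (T n w f) (T n w f') =
  4^-1 * (`|T n w (f + f')| ^+ 2 - `|T n w (f - f')| ^+ 2).
Proof. by have [_ TD TB _] := linear_opP (proj1 (bT n w));
  rewrite hdot_polar TD TB. Qed.

Let sumE m (a : 'I_m -> R) (f : 'I_m -> forall n, F n) w :
  `|TT w (\sum_(i < m) a i *: tens Fd (f i))| ^+ 2 = quadratic_form (fun i k =>
     \prod_n hdot (T n (w n) (f i n)) (T n (w n) (f k n))) a.
Proof.
rewrite /TT tensor_operator_sums ?normsq_tensor_sum//.
Qed.

Let measurable_sums h : tensor_sums h ->
    measurable_fun setT (fun w => `|TT w h| ^+ 2).
Proof.
move=> [m [a [f ->]]].
have -> : (fun w => `|TT w (\sum_(i < m) a i *: tens Fd (f i))| ^+ 2) =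
    fun w => quadratic_form (fun i k =>
      \prod_n hdot (T n (w n) (f i n)) (T n (w n) (f k n))) a.
  by apply/funext => w; exact: sumE.
apply: measurable_sum => i; apply: measurable_sum => k; apply: measurable_funM => //.
apply: (measurable_prod_coordinates predT
  (g := fun n x => hdot (T n x (f i n)) (T n x (f k n)))) => n.
under eq_fun do rewrite dotE.
by apply: measurable_funM => //; apply: measurable_funB.
Qed.

Let cvg_TT w (y : nat -> Fd) h : y k @[k --> \oo] --> h ->
  `|TT w (y k)| ^+ 2 @[k --> \oo] --> `|TT w h| ^+ 2.
Proof.
move=> yh; apply: cvg_sqr; apply: cvg_norm.
exact: (cvg_comp y (TT w) yh (proj2 (bTT w) h)).
Qed.

Lemma measurable_normsq_tensor h : measurable_fun setT (fun w => `|TT w h| ^+ 2).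
Proof.
have [y Sy yh] := dense_cvg h (@dense_tensor_sums R d F Fd).
apply: (measurable_fun_cvg (h := fun k w => `|TT w (y k)| ^+ 2)).
  by move=> k; exact: measurable_sums.
by move=> w _; exact: cvg_TT.
Qed.

(* The matrices E<T_n f_i, T_n f_k> are dominated by c_n^2 <f_i, f_k>; by
   independence their entrywise product over n governs E||(T_1 (x) ...) h||^2. *)
Lemma randomized_tensor_le h :
  (forall n f, (\int[P n]_w (`|T n w f| ^+ 2)%:E <= (c n ^+ 2 * `|f| ^+ 2)%:E)%E) ->
  (\int[PP]_w (`|TT w h| ^+ 2)%:E <= ((\prod_n c n) ^+ 2 * `|h| ^+ 2)%:E)%E.
Proof.
move=> Tc; have [y Sy yh] := dense_cvg h (@dense_tensor_sums R d F Fd).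
apply: (@fatou_le _ _ _ _ (fun k w => `|TT w (y k)| ^+ 2) _
  (fun k => (\prod_n c n) ^+ 2 * `|y k| ^+ 2)).
- by move=> k; exact: measurable_sums.
- by move=> k w; exact: sqr_ge0.
- by move=> w; exact: cvg_TT.
- move=> k; have [m [a [f ->]]] := Sy k.
  have iT n x : (P n).-integrable setT (EFin \o fun w => `|T n w x| ^+ 2).
    apply/integrableP; split; first exact/measurable_EFinP.
    have -> : (\int[P n]_w `|(EFin \o (fun w => `|T n w x| ^+ 2)%R) w| =
        \int[P n]_w (`|T n w x| ^+ 2)%:E)%E.
      by apply: eq_integral => w _; rewrite gee0_abs// lee_fin sqr_ge0.
    by rewrite (le_lt_trans (Tc n x))// ltry.
  have iD n x x' : (P n).-integrable setT
    (EFin \o fun w => hdot (T n w x) (T n w x')).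
    apply: (eq_integrable measurableT _ _ _ (integrableZl measurableT 4^-1
      (integrableB measurableT (iT n (x + x')) (iT n (x - x'))))) => w _ /=.
    by rewrite dotE.
  (* Independence enters here: the expectation of each Gram entry of the tensor product factors over
     the coordinates. *)
  have iP i j := integral_prod_coordinates hPP
    (g := fun n w => hdot (T n w (f i n)) (T n w (f j n))) (fun n => iD n _ _).
  have [iQ EQ] := Rintegral_quadratic_form (mu := PP)
    (M := fun w i j => \prod_n hdot (T n (w n) (f i n)) (T n (w n) (f j n)))
    a (fun i j => (iP i j).1).
  under eq_integral do rewrite sumE.
  rewrite fine_Rintegral// EQ lee_fin normsq_tensor_sum -prodrXl.
  have -> : quadratic_form (fun i j => \int[PP]_w
      \prod_n hdot (T n (w n) (f i n)) (T n (w n) (f j n))) a =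
    quadratic_form (fun i j => \prod_n \int[P n]_w hdot (T n w (f i n))
      (T n w (f j n))) a.
    by apply: eq_bigr => i _; apply: eq_bigr => j _; rewrite (iP i j).2.
  have dom n : psd_le (fun i j => \int[P n]_w hdot (T n w (f i n)) (T n w (f j n)))
      (fun i j => c n ^+ 2 * hdot (f i n) (f j n)).
    have E b : quadratic_form (fun i j =>
        \int[P n]_w hdot (T n w (f i n)) (T n w (f j n))) b =
        \int[P n]_w `|T n w (\sum_i b i *: f i n)| ^+ 2.
      rewrite -(Rintegral_quadratic_form b (fun i j => iD n _ _)).2.
      apply: eq_Rintegral => w _.
      by rewrite linear_op_sum ?normsq_sum//; exact: (proj1 (bT n w)).
    have sym i j : \int[P n]_w hdot (T n w (f i n)) (T n w (f j n)) =
        \int[P n]_w hdot (T n w (f j n)) (T n w (f i n)).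
      by apply: eq_Rintegral => w _; rewrite hdotC.
    split; first by split=> // b; rewrite E; apply: Rintegral_ge0 => w _;
      exact: sqr_ge0.
    split=> [i j|b]; first by rewrite sym (hdotC (f i n)).
    have -> : quadratic_form (fun i j => c n ^+ 2 * hdot (f i n) (f j n) -
        \int[P n]_w hdot (T n w (f i n)) (T n w (f j n))) b =
      c n ^+ 2 * `|\sum_i b i *: f i n| ^+ 2 -
        \int[P n]_w `|T n w (\sum_i b i *: f i n)| ^+ 2.
      rewrite -E normsq_sum /quadratic_form mulr_sumr -sumrB; apply: eq_bigr => i _.
      by rewrite mulr_sumr -sumrB; apply: eq_bigr => j _; ring.
    by rewrite subr_ge0 -lee_fin -fine_Rintegral.
  apply: le_trans (psd_le_form a (psd_le_prod (index_enum 'I_d) dom)) _.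
  rewrite /quadratic_form mulr_sumr ler_sum// => i _.
  by rewrite mulr_sumr ler_sum// => j _; rewrite big_split /= mulrCA.
- by apply: cvgMr; apply: cvg_sqr; apply: cvg_norm.
Qed.

(** Here the factors do have majorants at each w, so these multiply pointwise, and independence
    factors the expectation of their product. *)
Lemma worst_case_tensor_le (nu : forall n, Om n -> R) :
  (forall n, measurable_fun setT (nu n)) -> (forall n w, 0 <= nu n w) ->
  (forall n w f, `|T n w f| ^+ 2 <= nu n w * `|f| ^+ 2) ->
  (forall n, (\int[P n]_w (nu n w)%:E <= (c n ^+ 2)%:E)%E) ->
  [/\ measurable_fun setT (fun w : product_space Om => \prod_n nu n (w n)),
      forall w : product_space Om, 0 <= \prod_n nu n (w n),
      forall (w : product_space Om) h,
        `|TT w h| ^+ 2 <= (\prod_n nu n (w n)) * `|h| ^+ 2 &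
      (\int[PP]_w (\prod_n nu n (w n))%:E <= ((\prod_n c n) ^+ 2)%:E)%E].
Proof.
move=> mnu nu0 Tnu nuc; split.
- exact: measurable_prod_coordinates.
- by move=> w; apply: prodr_ge0.
- by move=> w h; apply: normsq_tensor_operator => n; [exact: bT|exact: Tnu].
have inu n : (P n).-integrable setT (EFin \o nu n).
  apply/integrableP; split; first exact/measurable_EFinP.
  have -> : (\int[P n]_w `|(EFin \o nu n) w| = \int[P n]_w (nu n w)%:E)%E.
    by apply: eq_integral => w _; rewrite gee0_abs// lee_fin.
  by rewrite (le_lt_trans (nuc n))// ltry.
rewrite (ge0_integral_prod_coordinates hPP)// lee_fin -prodrXl;
  apply: ler_prod => n _.
by rewrite Rintegral_ge0//= -lee_fin -fine_Rintegral.
Qed.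

End tensor_rms.


Lemma rms_le_tensor (R : realType) (d : nat) (F G : 'I_d -> hilbertType R)
    (Fd : hilbert_tensor F) (Gd : hilbert_tensor G)
    (disp : 'I_d -> measure_display) (Om : forall n, measurableType (disp n))
    (P : forall n, probability (Om n) R) (PP : probability (product_space Om) R)
    (x : setting) (T : forall n, Om n -> F n -> G n) (c : 'I_d -> R) :
  is_product_probability P PP ->
  (forall n, rms_le x (P n) (c n) (T n)) ->
  rms_le x PP (\prod_n c n)
    (fun w : product_space Om => tensor_operator Fd Gd (fun n => T n (w n))).
Proof.
move=> hPP Tc.
have bT n w : bounded_operator (T n w) by have [+ _ _] := Tc n; apply.
have mT n f : measurable_fun setT (fun w => `|T n w f| ^+ 2).
  by have [_ + _] := Tc n; apply.
split.
- by move=> w; apply: (tensor_operatorP Fd Gd _).1 => n; exact: bT.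
- exact: measurable_normsq_tensor.
case: x Tc => Tc.
  move=> h; apply: (randomized_tensor_le Gd hPP bT mT) => n.
  by have [_ _ +] := Tc n; apply.
have nuP n : exists nu : Om n -> R, [/\ measurable_fun setT nu, forall w, 0 <= nu w,
    forall w f, `|T n w f| ^+ 2 <= nu w * `|f| ^+ 2 &
    (\int[P n]_w (nu w)%:E <= (c n ^+ 2)%:E)%E].
  by have [_ _ +] := Tc n.
pose nu n := projT1 (cid (nuP n)).
have nuE n := projT2 (cid (nuP n)).
exists (fun w => \prod_n nu n (w n)).
by apply: (worst_case_tensor_le Fd Gd hPP) => //; move=> n; have [? ? ? ?] := nuE n.
Qed.

(** * Triangle inequality for the error norms *)

Section rms_sums.
Context (R : realType).

(* Replaces Minkowski's inequality: if c i bounds the root mean square of x i,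
   the right-hand side integrates to at most the square of the sum of the c i,
   and the sum of the x i need not be measurable. *)
Lemma normsq_sum_weighted (V : normedModType R) (I : Type) (r : seq I)
    (x : I -> V) (c : I -> R) : (forall i, 0 < c i) ->
  `|\sum_(i <- r) x i| ^+ 2 <=
  (\sum_(i <- r) c i) * (\sum_(i <- r) `|x i| ^+ 2 / c i).
Proof.
move=> c0; elim: r => [|i r]; first by rewrite !big_nil normr0 expr0n mul0r.
rewrite !big_cons.
have : 0 <= \sum_(j <- r) c j by apply: sumr_ge0 => j _; exact: ltW.
have : 0 <= \sum_(j <- r) `|x j| ^+ 2 / c j.
  by apply: sumr_ge0 => j _; rewrite divr_ge0 ?sqr_ge0// ltW.
move: (\sum_(j <- r) c j) (\sum_(j <- r) x j) (\sum_(j <- r) _ / _) =>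
  a y p p0 a0 yap.
have cx : 0 <= `|x i| ^+ 2 / c i by rewrite divr_ge0 ?sqr_ge0// ltW.
set q := `|x i| ^+ 2 / c i in cx *.
have xE : `|x i| ^+ 2 = c i * q by rewrite /q mulrCA divff ?mulr1// gt_eqF.
have h1 : `|x i + y| ^+ 2 <= (`|x i| + `|y|) ^+ 2.
  by rewrite lerXn2r ?nnegrE ?addr_ge0// ler_normD.
(* Arithmetic-geometric mean inequality, in squared form: 4 (c_i p)(a q) <= (c_i p + a q)^2. *)
have h2 : 2 * (`|x i| * `|y|) <= c i * p + a * q.
  have cp : 0 <= c i * p by rewrite mulr_ge0// ltW.
  have aq : 0 <= a * q by rewrite mulr_ge0.
  rewrite -ler_sqr ?nnegrE ?mulr_ge0 ?addr_ge0//.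
  have h3 : (`|x i| * `|y|) ^+ 2 <= (c i * p) * (a * q).
    rewrite exprMn xE [leRHS](_ : _ = (c i * q) * (a * p)); last by ring.
    by rewrite ler_wpM2l// mulr_ge0// ltW.
  apply: (@le_trans _ _ (4 * ((c i * p) * (a * q)))).
    by rewrite exprMn -natrX ler_wpM2l.
  rewrite -subr_ge0 [leRHS](_ : _ = (c i * p - a * q) ^+ 2) ?sqr_ge0//; ring.
apply: le_trans h1 _; rewrite sqrrD xE mulrDl !mulrDr; lra.
Qed.

Context disp (Om : measurableType disp) (P : probability Om R).

(** Division by [c i] turns the bound [c i ^+ 2] into [c i], so the second sum integrates to at most
    the first. *)
Lemma integral_weighted_sum (I : Type) (r : seq I) (c : I -> R) (nu : I -> Om -> R) :
  (forall i, 0 < c i) -> (forall i, measurable_fun setT (nu i)) ->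
  (forall i w, 0 <= nu i w) ->
  (forall i, (\int[P]_w (nu i w)%:E <= (c i ^+ 2)%:E)%E) ->
  (\int[P]_w ((\sum_(i <- r) c i) * (\sum_(i <- r) nu i w / c i))%:E <=
   ((\sum_(i <- r) c i) ^+ 2)%:E)%E.
Proof.
move=> c0 mnu nu0 nuc.
have C0 : 0 <= \sum_(i <- r) c i by apply: sumr_ge0 => i _; exact: ltW.
have mq i : measurable_fun setT (fun w => nu i w / c i) by exact: measurable_funM.
have q0 i w : 0 <= nu i w / c i by rewrite divr_ge0// ltW.
under eq_integral do rewrite EFinM.
rewrite ge0_integralZl//; last 2 first.
- by apply/measurable_EFinP; exact: measurable_sum.
- by move=> w _; rewrite lee_fin; apply: sumr_ge0.
rewrite expr2 EFinM; apply: lee_wpmul2l => //.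
under eq_integral do rewrite -sumEFin.
rewrite ge0_integral_sum//; last 2 first.
- by move=> i; exact/measurable_EFinP.
- by move=> i w _; rewrite lee_fin.
rewrite -sumEFin; apply: lee_sum => i _.
under eq_integral do rewrite mulrC EFinM.
have ci0 : (0 <= (c i)^-1%:E)%E by rewrite lee_fin invr_ge0 ltW.
rewrite ge0_integralZl//; last 2 first.
- exact/measurable_EFinP.
- by move=> w _; rewrite lee_fin.
have -> : (c i)%:E = ((c i)^-1%:E * (c i ^+ 2)%:E)%E.
  by rewrite -EFinM expr2 mulrA mulVf ?mul1r// gt_eqF.
by apply: lee_wpmul2l => //; rewrite lee_fin invr_ge0 ltW.
Qed.

Lemma rms_norm_sum (F G : normedModType R) x (I : Type) (r : seq I) (c : I -> R)
    (T : I -> Om -> F -> G) :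
  (forall i, 0 < c i) -> (forall i, rms_le x P (c i) (T i)) ->
  (rms_norm P x (fun w f => \sum_(i <- r) T i w f)%R <= (\sum_(i <- r) c i)%:E)%E.
Proof.
move=> c0 Tc; have C0 : 0 <= \sum_(i <- r) c i by apply: sumr_ge0 => i _; exact: ltW.
case: x Tc => Tc /=.
  apply: ge_ereal_sup => _ [f /= f1 <-]; apply: sqrte_le => //.
  apply: le_trans (@integral_weighted_sum _ r c (fun i w => `|T i w f| ^+ 2)
    c0 _ _ _).
  - apply: le_integral_ge0 => w; rewrite lee_fin ?sqr_ge0//.
    exact: normsq_sum_weighted.
  - by move=> i; have [_ + _] := Tc i; apply.
  - by move=> i w; exact: sqr_ge0.
  - move=> i; have [_ _ /(_ f)/le_trans] := Tc i; apply.
    by rewrite lee_fin ler_piMr ?sqr_ge0// expr_le1.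
pose nu i := projT1 (cid (let: And3 _ _ h := Tc i in h)).
have nuE i : [/\ measurable_fun setT (nu i), forall w, 0 <= nu i w,
    forall w f, `|T i w f| ^+ 2 <= nu i w * `|f| ^+ 2 &
    (\int[P]_w (nu i w)%:E <= (c i ^+ 2)%:E)%E].
  exact: (projT2 (cid (let: And3 _ _ h := Tc i in h))).
apply: sqrte_le => //.
apply: le_trans (@integral_weighted_sum _ r c nu c0 _ _ _); last 3 first.
- by move=> i; have [] := nuE i.
- by move=> i; have [] := nuE i.
- by move=> i; have [] := nuE i.
apply: le_integral_ge0 => w.
  apply: (@le_trans _ _ (`|(\sum_(i <- r) T i w 0)%R| ^+ 2)%:E).
    by rewrite lee_fin sqr_ge0.
  by apply: ereal_sup_ubound; exists 0 => //=; rewrite normr0.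
apply: ge_ereal_sup => _ [f /= f1 <-]; rewrite lee_fin.
apply: le_trans (normsq_sum_weighted r _ c0) _.
rewrite ler_wpM2l// ler_sum// => i _; rewrite ler_wpM2r// ?invr_ge0 ?(ltW (c0 i))//.
have [_ nu0 /(_ w f) Tf _] := nuE i; apply: le_trans Tf _.
by rewrite ler_piMr// expr_le1.
Qed.

End rms_sums.

Lemma rms_le_0 (R : realType) x disp (Om : measurableType disp) (P : probability Om R)
    (F G : normedModType R) (c : R) : rms_le x P c ((fun _ _ => 0) : Om -> F -> G).
Proof.
split=> [w|f|]; first exact: bounded_operator_cst0.
  by move=> _; under eq_fun do rewrite normr0 expr0n; exact: measurable_cst.
case: x => [f|].
  rewrite integral0_eq => [|w _]; last by rewrite normr0 expr0n.
  by rewrite lee_fin mulr_ge0 ?sqr_ge0.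
exists (cst 0); split=> // [w f|]; first by rewrite normr0 expr0n mul0r.
by rewrite integral0_eq// lee_fin sqr_ge0.
Qed.

Lemma prod_split_factor (R : comNzRingType) d (k : 'I_d) (a b c : R) :
  \prod_n @split_factor d (fun=> R) k (fun=> a) (fun=> b) (fun=> c) n =
    a ^+ k * b * c ^+ (d.-1 - k).
Proof.
pose f n := if (n < k)%N then a else if n == k then b else c.
rewrite [LHS](_ : _ = \prod_(n < d) f n)// -(big_mkord xpredT f).
rewrite (@big_cat_nat _ _ _ k)//=; last by rewrite ltnW.
rewrite [X in _ * X]big_ltn// /f ltnn eqxx mulrA; congr (_ * _ * _).
- rewrite (eq_big_nat _ _ (F2 := fun=> a)) => [|n /andP[_ ->]//].
  by rewrite prodr_const_nat subn0.
- rewrite (eq_big_nat _ _ (F2 := fun=> c)) => [|n /andP[kn _]]; last first.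
    by rewrite ltnNge (ltnW kn) gtn_eqF.
  by rewrite prodr_const_nat -subn1 -subnDA add1n.
Qed.

(** * Error of the Smolyak method *)

Section smolyak_bound.
Context (R : realType) (d : nat) (F G : 'I_d -> hilbertType R)
  (S : forall n, F n -> G n) (Fd : hilbert_tensor F) (Gd : hilbert_tensor G)
  (disp : 'I_d -> measure_display) (Om : forall n, measurableType (disp n))
  (U : forall n, nat -> Om n -> F n -> G n) (L : nat).
Arguments S : clear implicits.
Arguments U : clear implicits.
Hypotheses (dL : (d <= L)%N) (bS : forall n, bounded_operator (S n))
  (bU : forall n l w, bounded_operator (U n l w))
  (U0 : forall n w f, U n 0%N w f = 0).
Arguments bS : clear implicits.
Arguments bU : clear implicits.

Definition error_factor (k : nat) (l : {ffun 'I_d -> 'I_L.+1}) (n : 'I_d) :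
    Om n -> F n -> G n :=
  @split_factor d (fun n => Om n -> F n -> G n) k
    (fun n => increment (U n) (l n))
    (fun n w f => S n f - U n ((L - d + k).+1 - \sum_m l m)%N w f)
    (fun n w => S n) n.
Arguments error_factor : clear implicits.

Lemma bounded_error_factor k l n w : bounded_operator (error_factor k l n w).
Proof.
rewrite /error_factor /split_factor; case: ifP => _.
  exact: bounded_operatorB.
by case: ifP => // _; apply: bounded_operatorB.
Qed.

(** Both sides are bounded operators in h, so elementary tensors suffice; there the claim is the
    telescoping identity for the vectors S_n f_n and U_l f_n at fixed w. *)
Lemma smolyak_error_split (w : product_space Om) (h : Fd) :
  tensor_operator Fd Gd S h - smolyak Fd Gd U L w h =
  \sum_(k < d) \sum_(l : {ffun 'I_d -> 'I_L.+1} | padded_index k (L - d + k) l)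
    tensor_operator Fd Gd (fun n => error_factor k l n (w n)) h.
Proof.
have bI l n : bounded_operator (increment (U n) l (w n)) by exact: bounded_operatorB.
have bE k l n := bounded_error_factor k l (w n).
move: h; apply: eq_bounded_tensor => [||f].
- apply: bounded_operatorB; first exact: (tensor_operatorP Fd Gd bS).1.
  by apply: bounded_operator_sum => l; apply: (tensor_operatorP Fd Gd _).1.
- apply: bounded_operator_sum => k; apply: bounded_operator_sum => l.
  by apply: (tensor_operatorP Fd Gd _).1.
rewrite (tensor_operatorP Fd Gd bS).2 /smolyak.
under eq_bigr do rewrite (tensor_operatorP Fd Gd (fun n => bI _ n)).2.
rewrite (smolyak_telescope Gd (fun n => S n (f n))
  (u := fun n l => U n l (w n) (f n)) dL)//.
apply: eq_bigr => k _; apply: eq_bigr => l _.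
rewrite (tensor_operatorP Fd Gd (bE k l)).2; congr tens.
apply/functional_extensionality_dep => n; rewrite /error_factor /split_factor.
by case: ifP => // _; case: ifP.
Qed.

End smolyak_bound.

(** Since k < d, each increment level satisfies l_n <= |l| <= L-d+k <= L-1, and 1 <= K <= L;
    monotonicity then gives the common constants E_{L-1} and C_L. The factor D^{l_n} is uniform in n
    because the padding makes it 1 for n >= k. *)
Lemma rms_le_error_factor (R : realType) (d : nat) (F G : 'I_d -> hilbertType R)
    (sepF : forall n, separable (F n)) (sepG : forall n, separable (G n))
    (S : forall n, F n -> G n) (disp : 'I_d -> measure_display)
    (Om : forall n, measurableType (disp n)) (P : forall n, probability (Om n) R)
    (U : forall n, nat -> Om n -> F n -> G n) (L : nat) (x : setting)
    (B D : R) (C E : nat -> R) :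
  (d <= L)%N -> (forall n, bounded_operator (S n)) ->
  (forall n l, randomized_operator (U n l)) -> 0 < B -> 0 < D ->
  0 < C L -> 0 < E L.-1 ->
  (forall k l, (0 < k <= l)%N -> C k <= C l) ->
  (forall k l, (0 < k <= l)%N -> E k <= E l) ->
  (forall n, operator_norm (S n) <= B%:E)%E ->
  (forall n l, (0 < l)%N ->
    (rms_error (P n) x (S n) (U n l) <= (C l * D ^+ l)%:E)%E) ->
  (forall n l, (0 < l)%N ->
    (rms_norm (P n) x (increment (U n) l) <= (E l * D ^+ l)%:E)%E) ->
  forall (k n : 'I_d) (l : {ffun 'I_d -> 'I_L.+1}), padded_index k (L - d + k) l ->
  rms_le x (P n)
    (@split_factor d (fun=> R) k (fun=> E L.-1)
      (fun=> C L * D ^+ ((L - d + k).+1 - \sum_m l m)) (fun=> B) n * D ^+ l n)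
    (@error_factor R d F G S disp Om U L k l n).
Proof.
move=> dL bS rU B0 D0 C0 E0 ndC ndE SB errU incU k n l /andP[/forallP lk lsum].
have ML : (L - d + k < L)%N by rewrite -ltn_subRL subKn// ltn_ord.
have mB (f : F n) (X Y : Om n -> G n) : Defs.random_variable X ->
    Defs.random_variable Y -> measurable_fun setT (fun w => `|X w - Y w| ^+ 2).
  move=> mX mY; have mXY := measurable_normB (sepG n) mX mY.
  by under eq_fun do rewrite expr2; exact: measurable_funM.
rewrite /error_factor /split_factor; case: ltnP => [nk|kn].
  have ln0 : (0 < l n)%N by rewrite (eqP (lk n)).
  apply: rms_norm_rms_le => //.
  - by move=> w; apply: bounded_operatorB; apply: (rU n _).1.
  - by move=> f; apply: (mB f); apply: (rU n _).2.
  - exact: sepF.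
  apply: le_trans (incU n _ ln0) _.
  rewrite lee_fin ler_wpM2r ?exprn_ge0 ?(ltW D0)//; apply: ndE; rewrite ln0 /=.
  rewrite -ltnS (ltn_predK ML) (leq_ltn_trans _ ML)// (leq_trans _ lsum)//.
  by rewrite (bigD1 n)//= leq_addr.
have -> : l n = 0%N :> nat.
  by have := lk n; rewrite [(n < k)%N]ltnNge kn; case: (nat_of_ord (l n)).
rewrite expr0 mulr1; case: eqP => [nk|_]; last by apply: rms_le_cst => //; exact: ltW.
set K := ((L - d + k).+1 - _)%N.
have K0 : (0 < K)%N by rewrite subn_gt0 ltnS.
apply: rms_norm_rms_le => //.
- by move=> w; apply: bounded_operatorB => //; apply: (rU n _).1.
- move=> f; apply: (mB f); [exact: random_variable_cst|exact: (rU n _).2].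
- exact: sepF.
apply: le_trans (errU n _ K0) _.
rewrite lee_fin ler_wpM2r ?exprn_ge0 ?(ltW D0)//; apply: ndC; rewrite K0 /=.
exact: leq_trans (leq_subr _ _) ML.
Qed.

Theorem corollary4 (R : realType) (d : nat) (hd : (0 < d)%N)
  (* the spaces F^(n), G^(n) and the operators S^(n) *)
  (F G : 'I_d -> hilbertType R)
  (sepF : forall n, separable (F n)) (sepG : forall n, separable (G n))
  (X : 'I_d -> Type) (ev : forall n, F n -> X n -> R)
  (funF : forall n, function_space (ev n))
  (S : forall n, F n -> G n) (hS : forall n, bounded_operator (S n))
  (Fd : hilbert_tensor F) (Gd : hilbert_tensor G)
  (* the probability spaces and their product *)
  (disp : 'I_d -> measure_display) (Om : forall n, measurableType (disp n))
  (P : forall n, probability (Om n) R) (PP : probability (product_space Om) R)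
  (hPP : is_product_probability P PP)
  (* the building blocks U^(n)_l, with U^(n)_0 = 0 *)
  (U : forall n, nat -> Om n -> F n -> G n)
  (hU : forall n l, (0 < l)%N -> randomized_operator (U n l))
  (hU0 : forall n w f, U n 0%N w f = 0)
  (L : nat) (hL : (d <= L)%N) (x : setting)
  (* the constants, with E_0 = E_1 *)
  (B D : R) (hB : 0 < B) (hD : 0 < D < 1)
  (C E : nat -> R)
  (hC : forall l, (0 < l)%N -> 0 < C l)
  (hE : forall l, (0 < l)%N -> 0 < E l)
  (ndC : forall k l, (0 < k <= l)%N -> C k <= C l)
  (ndE : forall k l, (0 < k <= l)%N -> E k <= E l)
  (hE0 : E 0%N = E 1%N)
  (normS : forall n, (operator_norm (S n) <= B%:E)%E)
  (errU : forall n l, (0 < l)%N ->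
    (rms_error (P n) x (S n) (U n l) <= (C l * D ^+ l)%:E)%E)
  (caseR : x = Randomized -> forall n l, (0 < l)%N ->
    (forall f : F n, in_L2 (P n) (fun w => U n l w f)) /\
    (rms_norm (P n) Randomized (increment (U n) l) <= (E l * D ^+ l)%:E)%E)
  (caseW : x = WorstCase -> forall n l, (0 < l)%N ->
    let mu := fun w => operator_norm (U n l w) in
    [/\ forall w, (mu w < +oo)%E,
        measurable_fun [set: Om n] mu,
        ('N[P n]_2%:E[mu] < +oo)%E &
        (rms_norm (P n) WorstCase (increment (U n) l) <= (E l * D ^+ l)%:E)%E]) :
  let bound := C L * B ^+ d.-1 * D ^+ (L - d).+1 *
    \sum_(j < d) (E L.-1 * D / B) ^+ j * 'C(L - d + j, j)%:R in
  let H := Num.max (B / D) (E L.-1) in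
  (rms_error PP x (tensor_operator Fd Gd S) (smolyak Fd Gd U L) <= bound%:E)%E /\
  bound <= C L * H ^+ d.-1 * 'C(L, d.-1)%:R * D ^+ L.
Proof.
move=> bound H; have [D0 D1] := andP hD.
have L0 : (0 < L)%N by exact: leq_trans hL.
have C0 : 0 < C L by exact: hC.
(* For L = 1 this is E_0, whose positivity comes from the convention E_0 = E_1. *)
have E0 : 0 < E L.-1 by case: L.-1 => [|m]; [rewrite hE0|]; exact: hE.
have rU n l : randomized_operator (U n l).
  case: l => [|l]; last exact: hU.
  have -> : U n 0%N = fun _ _ => 0 by apply/funext => w; apply/funext => f.
  by split=> [w|f]; [exact: bounded_operator_cst0|exact: random_variable_cst].
have incU n l : (0 < l)%N ->
    (rms_norm (P n) x (increment (U n) l) <= (E l * D ^+ l)%:E)%E.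
  move=> l0; case: x caseR caseW {errU} => [h _|_ h].
    by have [_] := h erefl n l l0.
  by have [] := h erefl n l l0.
pose c (k : 'I_d) := C L * D ^+ (L - d + k).+1 * E L.-1 ^+ k * B ^+ (d.-1 - k).
have c0 k : 0 < c k by rewrite !mulr_gt0 ?exprn_gt0.
have factor_le := rms_le_error_factor sepF sepG hL hS rU hB D0 C0 E0 ndC ndE
  normS errU incU.
split.
  pose Q (p : 'I_d * {ffun 'I_d -> 'I_L.+1}) := padded_index p.1 (L - d + p.1) p.2.
  (* The bound for sums asks for an estimate at every index of the type, so inadmissible pairs
     receive the zero operator. *)
  pose T (p : 'I_d * {ffun 'I_d -> 'I_L.+1}) (w : product_space Om) : Fd -> Gd :=
    if Q p then tensor_operator Fd Gd
      (fun n => @error_factor R d F G S disp Om U L p.1 p.2 n (w n))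
    else fun=> 0.
  have cT p : rms_le x PP (c p.1) (T p).
    case: p => k l; rewrite /T /Q /=;
      case: (boolP (padded_index _ _ _)) => [kl|_]; last exact: rms_le_0.
    have -> : c k = \prod_n (@split_factor d (fun=> R) k (fun=> E L.-1)
        (fun=> C L * D ^+ ((L - d + k).+1 - \sum_m l m)) (fun=> B) n * D ^+ l n).
      rewrite big_split /= prod_split_factor -expr_sum /c.
      have /andP[_ lsum] := kl.
      have -> : D ^+ (L - d + k).+1 =
        D ^+ ((L - d + k).+1 - \sum_m l m) * D ^+ (\sum_m l m).
        by rewrite -exprD subnK// leqW.
      ring.
    by apply: (rms_le_tensor Fd Gd hPP) => n; exact: factor_le.
  have -> : bound = \sum_(p <- [seq p <- index_enum _ | Q p]) c p.1.
    rewrite big_filter -(pair_big_dep xpredT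
      (fun (k : 'I_d) (l : {ffun 'I_d -> 'I_L.+1}) => padded_index k (L - d + k) l)
      (fun k _ => c k)) /= /bound mulr_sumr; apply: eq_bigr => k _.
    have kd : (k <= d.-1)%N by rewrite -ltnS prednK.
    rewrite sumr_const -sum1_card card_padded_index//; last 2 first.
    - exact: ltnW.
    - by rewrite ltnW// -ltn_subRL subKn.
    rewrite -[c k *+ _]mulr_natr /c mulrA; congr (_ * _).
    rewrite -{1}(subnK kd) exprD -addSn exprD !exprMn exprVn; field.
    by rewrite expf_neq0// gt_eqF.
  have -> : rms_error PP x (tensor_operator Fd Gd S) (smolyak Fd Gd U L) =
      rms_norm PP x (fun w h => \sum_(p <- [seq p <- index_enum _ | Q p]) T p w h).
    congr rms_norm; apply/funext => w; apply/funext => h.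
    rewrite smolyak_error_split//; last by move=> n l w'; exact: (rU n l).1.
    rewrite big_filter (pair_big_dep xpredT
      (fun (k : 'I_d) (l : {ffun 'I_d -> 'I_L.+1}) =>
        padded_index k (L - d + k) l)) /=.
    by apply: eq_bigr => p Qp; rewrite /T ifT.
  by apply: rms_norm_sum => // p; exact: c0.
have H0 : 0 < H by rewrite lt_max E0 orbT.
have -> : C L * H ^+ d.-1 * 'C(L, d.-1)%:R * D ^+ L =
    \sum_(j < d) C L * D ^+ L * H ^+ d.-1 * 'C(L - d + j, j)%:R.
  rewrite -mulr_sumr -natr_sum.
  case: (d) hd hL => // m _ mL; rewrite sum_bin_diagonal -addnS subnK//=; ring.
rewrite /bound mulr_sumr; apply: ler_sum => j _.
rewrite mulrA ler_wpM2r//.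
have jd : (j <= d.-1)%N by rewrite -ltnS prednK.
(* Taking D^L out leaves d-1 factors, each B/D or E_{L-1} and thus at most H. *)
have -> : C L * B ^+ d.-1 * D ^+ (L - d).+1 * (E L.-1 * D / B) ^+ j =
    C L * D ^+ L * ((B / D) ^+ (d.-1 - j) * E L.-1 ^+ j).
  have LE : L = ((L - d).+1 + (d.-1 - j) + j)%N.
    by rewrite -addnA subnK// addSnnS prednK// subnK.
  have -> : D ^+ L = D ^+ (L - d).+1 * D ^+ (d.-1 - j) * D ^+ j
    by rewrite {1}LE !exprD.
  have -> : B ^+ d.-1 = B ^+ (d.-1 - j) * B ^+ j by rewrite -exprD subnK.
  rewrite !exprMn !exprVn; field.
  by rewrite !expf_neq0// gt_eqF.
rewrite ler_wpM2l ?mulr_ge0 ?exprn_ge0 ?(ltW C0) ?(ltW D0)//.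
have -> : H ^+ d.-1 = H ^+ (d.-1 - j) * H ^+ j by rewrite -exprD subnK.
rewrite ler_pM ?exprn_ge0 ?divr_ge0 ?(ltW hB) ?(ltW D0) ?(ltW E0)//.
  by rewrite lerXn2r ?nnegrE ?divr_ge0 ?(ltW hB) ?(ltW D0) ?(ltW H0)// le_max lexx.
by rewrite lerXn2r ?nnegrE ?(ltW E0) ?(ltW H0)// le_max lexx orbT.
Qed.
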